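(* Let $A,B,C$ be complex vector spaces of dimension $m$, with bases $(a_i)$, $(b_i)$, $(c_i)$, $1\le i\le m$, and let $T\in A\otimes B\otimes C$ be $1_A$-generic. Then $\dim G_T\le 2m^2-m-1$, and equality occurs uniquely (up to isomorphism of tensors) for the tensor $$T_0=a_1\otimes\Big(\sum_{j=1}^m b_j\otimes c_j\Big).$$
   Context: The group $GL(A)\times GL(B)\times GL(C)$ acts naturally on $A\otimes B\otimes C$; the kernel of the action is $\{(\lambda\,\mathrm{Id}_A,\mu\,\mathrm{Id}_B,\nu\,\mathrm{Id}_C):\lambda\mu\nu=1\}\cong(\mathbb C^* )^{2}$. The symmetry group $G_T$ of a tensor $T$ is the stabilizer of $T$ in the quotient $(GL(A)\times GL(B)\times GL(C))/(\mathbb C^* )^{2}$. Two tensors are isomorphic if they lie in the same $GL(A)\times GL(B)\times GL(C)$-orbit; isomorphic tensors are identified. $T$ is $1_A$-generic if the image of the induced map $T_A:A^*\to B\otimes C$ contains an element of rank $m$. *)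

(* Defs.v *)
From mathcomp Require Import all_boot all_order all_algebra.
From mathcomp Require Import classical_sets.
From mathcomp Require mpoly.
From mathcomp Require Import ring.

Set Implicit Arguments.
Unset Strict Implicit.
Unset Printing Implicit Defensive.

Import GRing.Theory.
Local Open Scope ring_scope.
Local Open Scope classical_set_scope.

Section KrullDimension.

Variables (S : Type) (closed : set (set S)) (X : set S).

Definition irreducible (F : set S) : Prop :=
  F !=set0 /\
  forall Z1 Z2, closed Z1 -> closed Z2 ->
    F `<=` Z1 `|` Z2 -> F `<=` Z1 \/ F `<=` Z2.

Definition closed_in (F : set S) : Prop :=
  exists Z, closed Z /\ F = X `&` Z.

Definition irreducible_chain (n : nat) (F : nat -> set S) : Prop :=
  (forall i, (i <= n)%N -> closed_in (F i) /\ irreducible (F i)) /\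
  (forall i, (i < n)%N -> F i `<` F i.+1).

Definition krull_dim_le (d : nat) : Prop :=
  forall n F, irreducible_chain n F -> (n <= d)%N.

Definition krull_dim_eq (d : nat) : Prop :=
  (exists F, irreducible_chain d F) /\ krull_dim_le d.

End KrullDimension.

Section Tensors.

Variables (K : fieldType) (m : nat).

(* A = B = C = 'cV[K]_m with the standard bases; the value of T at (i, j, k)
   is its coefficient on a_i (x) b_j (x) c_k. *)
Definition tensor := {ffun 'I_m * 'I_m * 'I_m -> K^o}.

Definition basis_vec (i : 'I_m) : 'cV[K]_m := delta_mx i 0.

Definition pure_tensor (a b c : 'cV[K]_m) : tensor :=
  [ffun p => a p.1.1 0 * b p.1.2 0 * c p.2 0].

(* T_A : A^* -> B (x) C, with A^* = 'rV[K]_m and B (x) C = 'M[K]_m. *)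
Definition flattening_A (T : tensor) (alpha : 'rV[K]_m) : 'M[K]_m :=
  \matrix_(j, k) \sum_i alpha 0 i * T (i, j, k).

Definition one_A_generic (T : tensor) : Prop :=
  exists alpha, \rank (flattening_A T alpha) = m.

Definition mx_triple := ('M[K]_m * 'M[K]_m * 'M[K]_m)%type.

Definition mul_triple (g h : mx_triple) : mx_triple :=
  (g.1.1 *m h.1.1, g.1.2 *m h.1.2, g.2 *m h.2).

Definition GL3 : set mx_triple :=
  [set g | [/\ g.1.1 \in unitmx, g.1.2 \in unitmx & g.2 \in unitmx]].

(* The linear extension of a (x) b (x) c |-> g.1.1 a (x) g.1.2 b (x) g.2 c. *)
Definition act (g : mx_triple) (T : tensor) : tensor :=
  \sum_i \sum_j \sum_k T (i, j, k) *:
    pure_tensor (g.1.1 *m basis_vec i) (g.1.2 *m basis_vec j)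
                (g.2 *m basis_vec k).

Definition isomorphic (T T' : tensor) : Prop :=
  exists2 g, GL3 g & act g T = T'.

Definition act_kernel : set mx_triple :=
  [set g | exists la mu nu : K,
     la * mu * nu = 1 /\ g = (la%:M, mu%:M, nu%:M)].

Definition coset (g : mx_triple) : set mx_triple :=
  [set mul_triple g n | n in act_kernel].

(* G_T, as a set of points of the quotient of GL3 by act_kernel. *)
Definition symmetry_group (T : tensor) : set (set mx_triple) :=
  [set coset g | g in [set g | GL3 g /\ act g T = T]].

Definition coords (g : mx_triple) : 'rV[K]_(m * m + m * m + m * m) :=
  row_mx (row_mx (mxvec g.1.1) (mxvec g.1.2)) (mxvec g.2).

Definition zero_locus
    (I : set (mpoly.mpoly (m * m + m * m + m * m) K)) : set mx_triple :=
  [set g | forall p, I p -> mpoly.meval (coords g 0) p = 0].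

(* Quotient of the Zariski topology of GL3, which is the Zariski topology of
   the algebraic group GL3 / act_kernel: a set of cosets is closed when its
   preimage in GL3 is the trace of a zero locus of polynomials (inverting the
   determinants gives no further closed subsets of GL3). *)
Definition zariski_closed (Z : set (set mx_triple)) : Prop :=
  exists I, GL3 `&` coset @^-1` Z = GL3 `&` zero_locus I.

Definition dim_symmetry_group_le (T : tensor) (d : nat) : Prop :=
  krull_dim_le zariski_closed (symmetry_group T) d.

Definition dim_symmetry_group_eq (T : tensor) (d : nat) : Prop :=
  krull_dim_eq zariski_closed (symmetry_group T) d.

(* a_1 is basis_vec (Ordinal m_gt0): indices start at 0. *)
Definition tensor_T0 (m_gt0 : (0 < m)%N) : tensor :=
  \sum_j pure_tensor (basis_vec (Ordinal m_gt0)) (basis_vec j) (basis_vec j).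

Lemma act_pure_tensor g a b c :
  act g (pure_tensor a b c) =
  pure_tensor (g.1.1 *m a) (g.1.2 *m b) (g.2 *m c).
Proof.
have mulE (M : 'M[K]_m) (i r : 'I_m) : (M *m basis_vec i) r 0 = M r i.
  rewrite mxE (bigD1 i) //= mxE !eqxx mulr1 big1 ?addr0 // => s /negbTE si.
  by rewrite mxE si mulr0.
apply/ffunP => -[[r s] t]; rewrite /act ffunE /= !mxE sum_ffunE -mulrA.
rewrite big_distrl /=; apply: eq_bigr => i _.
rewrite sum_ffunE big_distrl big_distrr /=; apply: eq_bigr => j _.
rewrite sum_ffunE !big_distrr /=; apply: eq_bigr => k _.
by rewrite !ffunE /= !mulE /GRing.scale /=; ring.
Qed.

Lemma act_mul g h T : act (mul_triple g h) T = act g (act h T).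
Proof.
have actD : {morph act g : U V / U + V}.
  move=> U V; rewrite /act -big_split; apply: eq_bigr => i _ /=.
  rewrite -big_split; apply: eq_bigr => j _ /=.
  rewrite -big_split; apply: eq_bigr => k _ /=.
  by rewrite ffunE scalerDl.
have actZ a U : act g (a *: U) = a *: act g U.
  rewrite /act !scaler_sumr; apply: eq_bigr => i _.
  rewrite !scaler_sumr; apply: eq_bigr => j _.
  rewrite !scaler_sumr; apply: eq_bigr => k _.
  by rewrite ffunE scalerA.
have act0 : act g 0 = 0 by have := actZ 0 0; rewrite !scale0r.
rewrite [act h T]/act (big_morph _ actD act0); apply: eq_bigr => i _.
rewrite (big_morph _ actD act0); apply: eq_bigr => j _.
rewrite (big_morph _ actD act0); apply: eq_bigr => k _.
by rewrite actZ act_pure_tensor !mulmxA.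
Qed.

Lemma act_kernel_trivial n T : act_kernel n -> act n T = T.
Proof.
case=> la [mu] [nu] [e ->]; apply/ffunP => -[[r s] t].
rewrite /act sum_ffunE (bigD1 r) //= sum_ffunE (bigD1 s) //=.
rewrite sum_ffunE (bigD1 t) //= !big1 ?addr0.
- by rewrite !ffunE /= !mul_scalar_mx !mxE !eqxx !mulr1 e /GRing.scale /= mulr1.
- move=> i /negbTE ir; rewrite sum_ffunE big1 // => j _.
  rewrite sum_ffunE big1 // => k _; rewrite !ffunE /= !mul_scalar_mx !mxE.
  by rewrite eq_sym ir /= mulr0 !mul0r scaler0.
- move=> j /negbTE js; rewrite sum_ffunE big1 // => k _.
  rewrite !ffunE /= !mul_scalar_mx !mxE.
  by rewrite [s == j]eq_sym js /= !(mulr0, mul0r) scaler0.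
- move=> k /negbTE kt; rewrite !ffunE /= !mul_scalar_mx !mxE.
  by rewrite [t == k]eq_sym kt /= !mulr0 scaler0.
Qed.

Lemma act_coset g h T : coset g h -> act h T = act g T.
Proof. by case=> n kn <-; rewrite act_mul (act_kernel_trivial _ kn). Qed.

End Tensors.

(* Main.v *)
Require Import Defs.
From mathcomp Require Import all_boot all_order all_algebra perm.
From mathcomp Require Import boolp classical_sets.
From mathcomp Require Import reals complex.
From mathcomp Require Import mpoly ring zify.

Set Implicit Arguments.
Unset Strict Implicit.
Unset Printing Implicit Defensive.

Import Order.TTheory GRing.Theory Num.Theory.
Local Open Scope ring_scope.
Local Open Scope complex_scope.

(* Let k be the rank of the flattening of T, an m x m^2 matrix, and let alpha be
   a covector with T_A(alpha) invertible. If g = (gA, gB, gC) fixes T, then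
   gB T_A(alpha gA) gC^T = T_A(alpha), so gC is a rational function of gB and of
   the k coordinates of alpha gA on the A-support of T; then gB and gC determine
   gA on that support. Hence g is rational in k + m (m - k) + m^2 parameters,
   two of which are set to 1 in a chart of the quotient by the kernel.
   A chain of n + 1 irreducible closed sets yields n functions that are
   algebraically independent on the largest one, and counting monomials in them
   against monomials in the parameters gives n <= 2 m^2 - k (m - 1) - 2. This is
   2 m^2 - m - 1 for k = 1 and less for k > 1, and k = 1 characterizes the orbit
   of T_0.
   For T_0, the stabilizer consists of the triples with gA a_1 = l a_1 and
   gC = l^-1 gB^-T. Intersecting with a flag of linear spaces of pairs (gA, gB),
   which frees one matrix entry at a time starting from the scalar pairs, gives
   a chain of length (m^2 - m) + (m^2 - 1); its members are irreducible since two
   points of one of them lie on a rational curve inside it. *)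

(** * Rational functions of finitely many parameters *)

Section RationalFunctions.

Variables (K : fieldType) (X : Type) (D : X -> Prop).
Variables (d : nat) (par : X -> 'I_d -> K).

(* On [D], [h] is a quotient of polynomials in the parameters [par], with a
   denominator that vanishes nowhere on [D]. *)
Definition ratl (h : X -> K) : Prop :=
  exists P Q : {mpoly K[d]}, forall x, D x ->
    Q.@[par x] != 0 /\ Q.@[par x] * h x = P.@[par x].

Definition ratl_mx p q (A : X -> 'M[K]_(p, q)) : Prop :=
  forall i j, ratl (fun x => A x i j).

Lemma eq_ratl h1 h2 : (forall x, D x -> h1 x = h2 x) -> ratl h1 -> ratl h2.
Proof.
by move=> e [P [Q PQ]]; exists P, Q => x Dx; rewrite -e //; apply: PQ.
Qed.

Lemma ratl_const c : ratl (fun=> c).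
Proof.
by exists c%:MP, 1 => x _; rewrite meval1 mevalC mul1r oner_eq0.
Qed.

Lemma ratl_par i : ratl (par^~ i).
Proof.
by exists 'X_i, 1 => x _; rewrite meval1 mevalXU mul1r oner_eq0.
Qed.

Lemma ratlD h1 h2 : ratl h1 -> ratl h2 -> ratl (fun x => h1 x + h2 x).
Proof.
move=> [P1 [Q1 e1]] [P2 [Q2 e2]]; exists (P1 * Q2 + P2 * Q1), (Q1 * Q2).
move=> x Dx; have [n1 {}e1] := e1 x Dx; have [n2 {}e2] := e2 x Dx.
by rewrite mevalD !mevalM mulf_neq0 // -e1 -e2; split => //; ring.
Qed.

Lemma ratlM h1 h2 : ratl h1 -> ratl h2 -> ratl (fun x => h1 x * h2 x).
Proof.
move=> [P1 [Q1 e1]] [P2 [Q2 e2]]; exists (P1 * P2), (Q1 * Q2).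
move=> x Dx; have [n1 {}e1] := e1 x Dx; have [n2 {}e2] := e2 x Dx.
by rewrite !mevalM mulf_neq0 // -e1 -e2; split => //; ring.
Qed.

Lemma ratlV h : (forall x, D x -> h x != 0) -> ratl h ->
  ratl (fun x => (h x)^-1).
Proof.
move=> hn0 [P [Q e]]; exists Q, P => x Dx.
have [Qn0 <-] := e x Dx; have hx := hn0 x Dx.
by rewrite mulf_neq0 // mulfK.
Qed.

Lemma ratl_sum (I : finType) (h : I -> X -> K) :
  (forall i, ratl (h i)) -> ratl (fun x => \sum_i h i x).
Proof.
move=> rh; elim: (index_enum I) => [|i r IH].
  by apply: eq_ratl (ratl_const 0) => x _; rewrite big_nil.
by apply: eq_ratl (ratlD (rh i) IH) => x _; rewrite big_cons.
Qed.

Lemma ratl_prod (I : finType) (h : I -> X -> K) :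
  (forall i, ratl (h i)) -> ratl (fun x => \prod_i h i x).
Proof.
move=> rh; elim: (index_enum I) => [|i r IH].
  by apply: eq_ratl (ratl_const 1) => x _; rewrite big_nil.
by apply: eq_ratl (ratlM (rh i) IH) => x _; rewrite big_cons.
Qed.

Lemma ratlX h n : ratl h -> ratl (fun x => h x ^+ n).
Proof.
move=> rh; apply: eq_ratl (ratl_prod (fun _ : 'I_n => rh)) => x _.
by rewrite prodr_const card_ord.
Qed.

Lemma ratl_meval N (z : X -> 'I_N -> K) (p : {mpoly K[N]}) :
  (forall i, ratl (fun x => z x i)) -> ratl (fun x => p.@[z x]).
Proof.
move=> rz.
have: ratl (fun x => \sum_(m <- msupp p) p@_m * \prod_i z x i ^+ m i).
  elim: (msupp p : seq _) => [|m r IH].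
    by apply: eq_ratl (ratl_const 0) => x _; rewrite big_nil.
  have rm := ratlM (ratl_const p@_m) (ratl_prod (fun i => ratlX (m i) (rz i))).
  by apply: eq_ratl (ratlD rm IH) => x _; rewrite big_cons.
by apply: eq_ratl => x _; rewrite mevalE.
Qed.

Lemma eq_ratl_mx p q (A B : X -> 'M[K]_(p, q)) :
  (forall x, D x -> A x = B x) -> ratl_mx A -> ratl_mx B.
Proof. by move=> e rA i j; apply: eq_ratl (rA i j) => x /e ->. Qed.

Lemma ratl_mx_const p q (M : 'M[K]_(p, q)) : ratl_mx (fun=> M).
Proof. by move=> i j; apply: ratl_const. Qed.

Lemma ratl_tr p q (A : X -> 'M[K]_(p, q)) :
  ratl_mx A -> ratl_mx (fun x => (A x)^T).
Proof. by move=> rA i j; apply: eq_ratl (rA j i) => x _; rewrite mxE. Qed.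

Lemma ratl_scalemx p q a (A : X -> 'M[K]_(p, q)) :
  ratl a -> ratl_mx A -> ratl_mx (fun x => a x *: A x).
Proof.
by move=> ra rA i j; apply: eq_ratl (ratlM ra (rA i j)) => x _; rewrite mxE.
Qed.

Lemma ratl_addmx p q (A B : X -> 'M[K]_(p, q)) :
  ratl_mx A -> ratl_mx B -> ratl_mx (fun x => A x + B x).
Proof.
by move=> rA rB i j; apply: eq_ratl (ratlD (rA i j) (rB i j)) => x _; rewrite mxE.
Qed.

Lemma ratl_mulmx p q r (A : X -> 'M[K]_(p, q)) (B : X -> 'M[K]_(q, r)) :
  ratl_mx A -> ratl_mx B -> ratl_mx (fun x => A x *m B x).
Proof.
move=> rA rB i j.
by apply: eq_ratl (ratl_sum (fun k => ratlM (rA i k) (rB k j))) => x _; rewrite mxE.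
Qed.

Lemma ratl_mxvec p q (A : X -> 'M[K]_(p, q)) :
  ratl_mx A -> ratl_mx (fun x => mxvec (A x)).
Proof.
move=> rA i j; rewrite (ord1 i); case/mxvec_indexP: j => k l.
by apply: eq_ratl (rA k l) => x _; rewrite mxvecE.
Qed.

Lemma ratl_vec_mx p q (A : X -> 'rV[K]_(p * q)) :
  ratl_mx A -> ratl_mx (fun x => vec_mx (A x)).
Proof.
by move=> rA i j; apply: eq_ratl (rA 0 (mxvec_index i j)) => x _; rewrite mxE.
Qed.

Lemma ratl_det n (A : X -> 'M[K]_n) :
  ratl_mx A -> ratl (fun x => \det (A x)).
Proof.
move=> rA; apply: ratl_sum => s; apply: ratlM; first exact: ratl_const.
exact: (ratl_prod (fun i => rA i (s i))).
Qed.

Lemma ratl_invmx n (A : X -> 'M[K]_n) :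
  (forall x, D x -> A x \in unitmx) -> ratl_mx A ->
  ratl_mx (fun x => invmx (A x)).
Proof.
move=> uA rA.
have rV : ratl (fun x => (\det (A x))^-1).
  apply: ratlV (ratl_det rA) => x /uA.
  by rewrite unitmxE unitfE.
have radj : ratl_mx (fun x => \adj (A x)).
  move=> i j.
  apply: (@eq_ratl (fun x => (-1) ^+ (j + i) * \det (row' j (col' i (A x))))).
    by move=> x _; rewrite mxE.
  apply: ratlM (ratl_const _) (ratl_det _) => k l.
  by apply: eq_ratl (rA (lift j k) (lift i l)) => x _; rewrite !mxE.
by apply: eq_ratl_mx (ratl_scalemx rV radj) => x Dx; rewrite /invmx uA.
Qed.

End RationalFunctions.

Lemma ratl_sub (K : fieldType) X (D D' : X -> Prop) d (par : X -> 'I_d -> K) h :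
  (forall x, D' x -> D x) -> ratl D par h -> ratl D' par h.
Proof. by move=> DD [P [Q PQ]]; exists P, Q => x /DD; apply: PQ. Qed.

(** * Algebraic independence along chains *)

Section AlgebraicIndependence.

Variables (K : fieldType) (X : Type) (N : nat) (z : X -> 'I_N -> K).

Definition monomial (fs : seq {mpoly K[N]}) (e : seq nat) : {mpoly K[N]} :=
  \prod_(p <- zip fs e) p.1 ^+ p.2.

(* Only the monomials with all exponents less than [s] are tested, and there
   are [s ^ size fs] of them. *)
Definition alg_indep_below (s : nat) (F : X -> Prop) fs : Prop :=
  exists (J : finType) (e : J -> seq nat),
    [/\ #|J| = (s ^ size fs)%N,
        forall a, size (e a) = size fs /\ all (ltn^~ s) (e a)
      & forall c : J -> K,
          (forall x, F x -> (\sum_a c a *: monomial fs (e a)).@[z x] = 0) ->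
          forall a, c a = 0].

Definition vanishes_on (F : X -> Prop) (p : {mpoly K[N]}) : Prop :=
  forall x, F x -> p.@[z x] = 0.

Definition prime_on (F : X -> Prop) : Prop :=
  forall p q, vanishes_on F (p * q) -> vanishes_on F p \/ vanishes_on F q.

(* In a vanishing combination, the least power of [f] with a nonzero coefficient
   can be cancelled by primality; restricting the quotient to [F] then kills
   that coefficient. *)
Lemma alg_indep_belowS s (F F' : X -> Prop) fs f :
  (forall x, F x -> F' x) -> prime_on F' ->
  vanishes_on F f -> ~ vanishes_on F' f ->
  alg_indep_below s F fs -> alg_indep_below s F' (f :: fs).
Proof.
move=> FF' prF' fF fF' [J [e [cardJ eP indep]]].
exists (J * 'I_s)%type, (fun a => val a.2 :: e a.1); split.
- by rewrite card_prod card_ord cardJ /= expnSr.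
- by case=> a j /=; have [-> ->] := eP a; rewrite ltn_ord.
move=> c c0.
have fjn0 j : ~ vanishes_on F' (f ^+ j).
  elim: j => [|j IH] fj0.
    apply: fF' => x /fj0; rewrite expr0 meval1 => /eqP.
    by rewrite oner_eq0.
  by rewrite exprS in fj0; case: (prF' _ _ fj0).
(* [S j] is the coefficient of [f ^+ j] in the combination, extended by 0 to every natural [j] so
   that the strong induction below carries no bound. *)
pose S j : {mpoly K[N]} := if insub j is Some k then
  \sum_a c (a, k) *: monomial fs (e a) else 0.
have Sle j : (s <= j)%N -> S j = 0 by move=> sj; rewrite /S insubF // ltnNge sj.
have sumE : \sum_a c a *: monomial (f :: fs) (val a.2 :: e a.1) =
            \sum_(j < s) f ^+ j * S j.
  transitivity (\sum_a \sum_(j < s)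
      c (a, j) *: monomial (f :: fs) (val j :: e a)).
    by rewrite pair_bigA /=; apply: eq_bigr => -[a j].
  rewrite exchange_big; apply: eq_bigr => j _.
  rewrite /S valK big_distrr /=; apply: eq_bigr => a _.
  by rewrite /monomial /= big_cons /= scalerAr.
have S0 j : vanishes_on F (S j).
  have [t] := ubnP j; elim: t j => // t IH j; rewrite ltnS => jt.
  have [sj|js] := leqP s j.
    by move=> x _; rewrite Sle // meval0.
  (* A lower coefficient vanishes on [F] by induction, and independence of [fs] on [F] upgrades this
     to vanishing as a polynomial. *)
  have Si0 i : (i < j)%N -> S i = 0.
    move=> ij; rewrite /S; case: insubP => // k _ ik.
    apply: big1 => a _.
    suff -> : c (a, k) = 0 by rewrite scale0r.
    apply: (indep (fun a => c (a, k))) => x Fx.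
    have {}IH : vanishes_on F (S i) by apply: IH; lia.
    by have := IH x Fx; rewrite /S -ik valK.
  pose rest : {mpoly K[N]} := \sum_(i < s | (j < i)%N) f ^+ (i - j.+1) * S i.
  have E : \sum_(i < s) f ^+ i * S i = f ^+ j * (S j + f * rest).
    rewrite (bigID (fun i : 'I_s => (i <= j)%N)) /=.
    rewrite (bigD1 (Ordinal js)) //= big1 ?addr0; last first.
      move=> i /andP[ij /eqP ne]; rewrite Si0 ?mulr0 //.
      by rewrite ltn_neqAle ij andbT; apply/eqP => e0; apply/ne/val_inj.
    rewrite mulrDr; congr (_ + _); rewrite /rest !big_distrr /=.
    apply: eq_big => [i|i]; first by rewrite ltnNge.
    rewrite -ltnNge => ji; rewrite !mulrA -exprSr -exprD.
    by congr (_ ^+ _ * _); lia.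
  have: vanishes_on F' (f ^+ j * (S j + f * rest)).
    by rewrite -E -sumE => x /c0.
  case/prF' => [/fjn0//|v x Fx].
  by have := v x (FF' x Fx); rewrite mevalD mevalM fF // mul0r addr0.
case=> a j; apply: (indep (fun a => c (a, j))) => x Fx.
by have := S0 j x Fx; rewrite /S valK.
Qed.

(** Each inclusion contributes the function that separates its two members. The induction starts
    from the empty family, whose only monomial is 1; a point of [F 0] makes it independent. *)
Lemma chain_alg_indep n (F : nat -> X -> Prop) :
  (exists x, F 0 x) ->
  (forall i, (i <= n)%N -> prime_on (F i)) ->
  (forall i, (i < n)%N -> (forall x, F i x -> F i.+1 x) /\
     exists2 f, vanishes_on (F i) f & ~ vanishes_on (F i.+1) f) ->
  exists2 fs, size fs = n & forall s, alg_indep_below s (F n) fs.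
Proof.
move=> [x0 Fx0] prF stepF.
elim: n prF stepF => [|n IH] prF stepF.
  exists [::] => // s; exists unit, (fun=> [::]); split => //.
    by rewrite card_unit.
  move=> c /(_ x0 Fx0); rewrite (big_pred1 tt) => [|[]//].
  by rewrite mevalZ /monomial big_nil meval1 mulr1 => c0 [].
have [||fs sz ind] := IH.
- by move=> i ile; apply: prF; lia.
- by move=> i ile; apply: stepF; lia.
have [FS [f fF fF']] := stepF n (ltnSn n).
exists (f :: fs); first by rewrite /= sz.
by move=> s; apply: (alg_indep_belowS FS _ fF fF' (ind s)); apply: prF.
Qed.

End AlgebraicIndependence.

(** * Counting monomials against parameters *)

Section Counting.

(** [msize] is one more than the degree, and 0 for the zero polynomial. Bounds of the form [a.+1]
    thus say degree at most [a], and they add up even when a factor is 0. *)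
Lemma msizeM_leS (K : fieldType) d (p q : {mpoly K[d]}) a b :
  (msize p <= a.+1 -> msize q <= b.+1 -> msize (p * q) <= (a + b).+1)%N.
Proof.
have [->|p0] := eqVneq p 0; first by rewrite mul0r msize0.
have [->|q0] := eqVneq q 0; first by rewrite mulr0 msize0.
move=> pa qb; rewrite msizeM // -ltnS prednK; last first.
  by rewrite addn_gt0 lt0n msize_poly_eq0 p0.
by rewrite -addnS -addSn leq_add.
Qed.

Lemma msizeX_leS (K : fieldType) d (p : {mpoly K[d]}) a k :
  (msize p <= a.+1 -> msize (p ^+ k) <= (a * k).+1)%N.
Proof.
move=> pa; elim: k => [|k IH]; first by rewrite expr0 msize1.
by rewrite exprS mulnS; apply: msizeM_leS.
Qed.

Lemma card_bmultinom_le d t : (#|{: 'X_{1..d < t}}| <= t ^ d)%N.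
Proof.
case: t => [|t].
  rewrite eq_card0 // => m.
  by have := bmdeg m; rewrite ltn0.
have mt (m : 'X_{1..d < t.+1}) i : (m i < t.+1)%N.
  apply: leq_ltn_trans (bmdeg m); rewrite mdegE (bigD1 i) //=; exact: leq_addr.
rewrite -[X in (X ^ d)%N]card_ord -[X in (_ ^ X)%N](card_ord d) -card_ffun.
apply: (@leq_card _ _ (fun m => [ffun i => Ordinal (mt m i)])) => m1 m2 e.
apply/val_inj/mnmP => i.
by have /(congr1 val) := congr1 (fun f : {ffun _} => f i) e; rewrite !ffunE.
Qed.

(** The coefficient matrix has more rows than columns, so its left kernel contains a nonzero row,
    whose entries are the coefficients of the relation. *)
Lemma mpoly_lin_dep (K : fieldType) d t (J : finType) (P : J -> {mpoly K[d]}) :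
  (forall a, (msize (P a) <= t)%N) -> (t ^ d < #|J|)%N ->
  exists c : J -> K, (exists a, c a != 0) /\ \sum_a c a *: P a = 0.
Proof.
move=> sP cJ; pose B : finType := 'X_{1..d < t}.
pose A := \matrix_(i < #|J|, j < #|B|) (P (enum_val i))@_(enum_val j : B).
have : kermx A != 0.
  rewrite kermx_eq0 /row_free; apply/eqP => rA.
  by have := rank_leq_col A; rewrite rA leqNgt (leq_ltn_trans (card_bmultinom_le d t)).
case/matrix0Pn => i [j kij].
exists (fun a => kermx A i (enum_rank a)); split.
  by exists (enum_val j); rewrite enum_valK.
transitivity (\sum_(b : B) (row i (kermx A) *m A) 0 (enum_rank b) *: 'X_[b] : {mpoly K[d]}).
  rewrite (eq_bigr (fun a => \sum_(b : B)
    (kermx A i (enum_rank a) * (P a)@_b) *: 'X_[b])); last first.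
    move=> a _; rewrite [in LHS](mpolywE (sP a)) scaler_sumr.
    by apply: eq_bigr => b _; rewrite scalerA.
  rewrite exchange_big /=; apply: eq_bigr => b _.
  rewrite -scaler_suml mxE; congr (_ *: _).
  rewrite (reindex (@enum_val J predT)) /=; last first.
    by apply: onW_bij; apply: enum_val_bij.
  by apply: eq_bigr => k _; rewrite !mxE enum_valK enum_rankK.
by apply: big1 => b _; rewrite -row_mul mulmx_ker row0 mxE scale0r.
Qed.

Lemma expn_growth n d c : (forall s, (s ^ n <= (c * s).+1 ^ d)%N) -> (n <= d)%N.
Proof.
move=> H; rewrite leqNgt; apply/negP => dn.
(* For this [s] and [d < n], [(c s + 1) ^ d <= (c + 1) ^ d s ^ d < s ^ d.+1 <= s ^ n]. *)
pose s := (c.+1 ^ d).+1.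
have /negP[] : ~~ (s ^ n <= (c * s).+1 ^ d)%N; last exact: H.
rewrite -ltnNge; apply: (@leq_ltn_trans ((c.+1 * s) ^ d)%N).
  by case: (posnP d) => [->//|d0]; rewrite leq_exp2r // mulSn -add1n leq_add2r.
rewrite expnMn; apply: (@leq_trans (s ^ d.+1)%N).
  by rewrite expnS ltn_pmul2r ?expn_gt0.
by rewrite leq_pexp2l.
Qed.

Variables (K : fieldType) (X : Type) (D : X -> Prop).
Variables (d : nat) (par : X -> 'I_d -> K).
Variables (N : nat) (z : X -> 'I_N -> K).
Hypothesis zR : forall i, ratl D par (fun x => z x i).

(** A single denominator and a single degree bound for the whole list keep the degrees of the
    numerators of monomials linear in the exponents, as the counting requires. *)
Lemma common_denominator (fs : seq {mpoly K[N]}) :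
  exists (Q : {mpoly K[d]}) (E : nat),
    [/\ forall x, D x -> Q.@[par x] != 0, (msize Q <= E.+1)%N
      & forall f, f \in fs -> exists2 P : {mpoly K[d]}, (msize P <= E.+1)%N
          & forall x, D x -> Q.@[par x] * f.@[z x] = P.@[par x]].
Proof.
elim: fs => [|f fs [Q0 [E0 [Qn0 sQ0 PQ0]]]].
  exists 1, 0%N; split; rewrite ?msize1 //.
  by move=> x _; rewrite meval1 oner_eq0.
have [P1 [Q1 PQ1]] := ratl_meval f zR.
exists (Q0 * Q1), (E0 + (msize Q1 + msize P1))%N; split.
- by move=> x Dx; rewrite mevalM mulf_neq0 ?Qn0 //; have [] := PQ1 x Dx.
- by apply: msizeM_leS => //; lia.
move=> g; rewrite inE => /orP[/eqP ->|gfs].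
  exists (Q0 * P1); first by apply: msizeM_leS => //; lia.
  by move=> x Dx; have [_ e] := PQ1 x Dx; rewrite !mevalM -mulrA e.
have [P sP e] := PQ0 g gfs; exists (P * Q1); first by apply: msizeM_leS => //; lia.
by move=> x Dx; rewrite !mevalM -e // mulrAC.
Qed.

Lemma monomial_numerator (Q : {mpoly K[d]}) E s (fs : seq {mpoly K[N]}) e :
  (msize Q <= E.+1)%N ->
  (forall f, f \in fs -> exists2 P : {mpoly K[d]}, (msize P <= E.+1)%N
     & forall x, D x -> Q.@[par x] * f.@[z x] = P.@[par x]) ->
  size e = size fs -> all (ltn^~ s) e ->
  exists2 P : {mpoly K[d]}, (msize P <= (E * (size fs * s)).+1)%N
    & forall x, D x ->
        Q.@[par x] ^+ (size fs * s) * (monomial fs e).@[z x] = P.@[par x].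
Proof.
move=> sQ; elim: fs e => [|f fs IH] [|j e] //=.
  move=> _ _ _; exists 1; rewrite ?msize1 //.
  by move=> x _; rewrite /monomial big_nil !meval1 expr0 mulr1.
move=> PQ [sze] /andP[js es].
have [|P sP eP] := IH e _ sze es; first by move=> g gfs; apply: PQ; rewrite inE gfs orbT.
have [|P1 sP1 eP1] := PQ f; first exact: mem_head.
(* The factor [f ^+ j] uses [j] copies of [Q]; the remaining [s - j] pad the power so that it is the
   same for all exponents. *)
exists (Q ^+ (s - j) * P1 ^+ j * P).
  have -> : (E * (s + size fs * s) = E * (s - j) + E * j + E * (size fs * s))%N.
    by rewrite -mulnDr subnK ?(ltnW js) // mulnDr.
  by rewrite !msizeM_leS ?msizeX_leS.
move=> x Dx; rewrite /monomial /= big_cons /= !mevalM -eP // !rmorphXn /= -eP1 //.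
rewrite mulSn exprD -{1}(subnK (ltnW js)) exprD exprMn /monomial.
by rewrite -!mulrA; do 2!congr (_ * _); rewrite mulrCA.
Qed.

(** The [s ^ size fs] monomials have numerators of degree at most [E * size fs * s] in [d]
    variables. A linear relation between the numerators descends to the monomials, because the power
    of [Q] that multiplies all of them vanishes nowhere on [D]. *)
Lemma alg_indep_le (F : X -> Prop) fs :
  (forall x, F x -> D x) ->
  (forall s, alg_indep_below z s F fs) -> (size fs <= d)%N.
Proof.
move=> FD ind.
have [Q [E [Qn0 sQ PQ]]] := common_denominator fs.
apply: (@expn_growth _ _ (E * size fs)) => s.
have [J [e [cJ eP indep]]] := ind s.
rewrite -cJ -mulnA leqNgt; apply/negP => big.
have num a : exists P : {mpoly K[d]}, (msize P <= (E * (size fs * s)).+1)%N /\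
    forall x, D x ->
      Q.@[par x] ^+ (size fs * s) * (monomial fs (e a)).@[z x] = P.@[par x].
  have [sz al] := eP a.
  by have [P sP eqP] := monomial_numerator sQ PQ sz al; exists P.
have [P PP] := choice num.
have [c [[a ca] c0]] := mpoly_lin_dep (fun a => (PP a).1) big.
move/negP: ca; apply; apply/eqP; apply: indep => x Fx.
have Dx := FD x Fx.
have: Q.@[par x] ^+ (size fs * s) *
    (\sum_a c a *: monomial fs (e a)).@[z x] = 0.
  have := congr1 (meval (par x)) c0; rewrite meval0 !raddf_sum big_distrr /=.
  move=> sum0; rewrite -[RHS]sum0; apply: eq_bigr => b _.
  by rewrite !mevalZ; have [_ <-] := PP b; rewrite // mulrCA.
by move/eqP; rewrite mulf_eq0 expf_eq0 (negbTE (Qn0 x Dx)) andbF => /eqP.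
Qed.

End Counting.

(** * Charts of the quotient by the kernel *)

Section Charts.

Local Open Scope classical_set_scope.

Variables (K : fieldType) (m : nat).
Implicit Types g h n : mx_triple K m.

Notation N := (m * m + m * m + m * m)%N.

Definition pt g : 'I_N -> K := coords g 0.

Lemma ratl_coords (X : Type) (D : X -> Prop) d (par : X -> 'I_d -> K)
    (g : X -> mx_triple K m) i :
  ratl_mx D par (fun x => (g x).1.1) -> ratl_mx D par (fun x => (g x).1.2) ->
  ratl_mx D par (fun x => (g x).2) -> ratl D par (fun x => pt (g x) i).
Proof.
move=> rA rB rC.
have rv (M : X -> 'M[K]_m) k : ratl_mx D par M ->
    ratl D par (fun x => mxvec (M x) 0 k) by move=> rM; apply: ratl_mxvec.
case: (split_ordP i) => k ->; last first.
  by apply: eq_ratl (rv _ k rC) => x _; rewrite /pt /coords row_mxEr.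
case: (split_ordP k) => l ->.
  by apply: eq_ratl (rv _ l rA) => x _; rewrite /pt /coords !row_mxEl.
by apply: eq_ratl (rv _ l rB) => x _; rewrite /pt /coords row_mxEl row_mxEr.
Qed.

Lemma ratl_entriesA D : ratl_mx D pt (fun g => g.1.1).
Proof.
move=> i j; apply: eq_ratl (ratl_par D pt (lshift _ (lshift _ (mxvec_index i j)))).
by move=> g _; rewrite /pt /coords !row_mxEl mxvecE.
Qed.

Lemma ratl_entriesB D : ratl_mx D pt (fun g => g.1.2).
Proof.
move=> i j; apply: eq_ratl (ratl_par D pt (lshift _ (rshift _ (mxvec_index i j)))).
by move=> g _; rewrite /pt /coords row_mxEl row_mxEr mxvecE.
Qed.

Lemma ratl_entriesC D : ratl_mx D pt (fun g => g.2).
Proof.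
move=> i j; apply: eq_ratl (ratl_par D pt (rshift _ (mxvec_index i j))).
by move=> g _; rewrite /pt /coords row_mxEr mxvecE.
Qed.

Definition scalar_triple (la mu nu : K) : mx_triple K m :=
  (la%:M, mu%:M, nu%:M).

Lemma mul_scalar_triple g la mu nu :
  mul_triple g (scalar_triple la mu nu) = (la *: g.1.1, mu *: g.1.2, nu *: g.2).
Proof. by rewrite /mul_triple /= !mul_mx_scalar. Qed.

Lemma mul_act_kernel n n' : act_kernel n -> act_kernel n' ->
  act_kernel (mul_triple n n').
Proof.
move=> [la [mu [nu [e ->]]]] [la' [mu' [nu' [e' ->]]]].
exists (la * la'), (mu * mu'), (nu * nu'); split.
  by rewrite -(mulr1 1) -{1}e -e'; ring.
by rewrite /mul_triple /= -!scalar_mxM.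
Qed.

Lemma act_kernelV n : act_kernel n ->
  exists2 n', act_kernel n' & forall g, mul_triple (mul_triple g n) n' = g.
Proof.
move=> [la [mu [nu [e ->]]]].
have : la * mu * nu != 0 by rewrite e oner_eq0.
rewrite !mulf_eq0 !negb_or => /andP[/andP[l0 m0] n0].
exists (scalar_triple la^-1 mu^-1 nu^-1).
  by exists la^-1, mu^-1, nu^-1; rewrite -!invfM e invr1.
case=> -[a b] c; rewrite mul_scalar_triple /mul_triple /= !mul_mx_scalar.
by rewrite !scalerA !mulVf // !scale1r.
Qed.

Lemma mul_tripleA g h n :
  mul_triple g (mul_triple h n) = mul_triple (mul_triple g h) n.
Proof. by rewrite /mul_triple /= !mulmxA. Qed.

Lemma coset_mul g n : act_kernel n -> coset (mul_triple g n) = coset g.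
Proof.
move=> kn; apply/seteqP; split => h [n' kn' <-].
  by exists (mul_triple n n'); [apply: mul_act_kernel|rewrite mul_tripleA].
have [n1 kn1 e] := act_kernelV kn.
exists (mul_triple n1 n'); first exact: mul_act_kernel.
by rewrite mul_tripleA e.
Qed.

Lemma mem_coset g : coset g g.
Proof.
exists (scalar_triple 1 1 1); first by exists 1, 1, 1; rewrite !mulr1.
by rewrite mul_scalar_triple !scale1r; case: g => -[].
Qed.

Lemma eq_coset g h : coset g = coset h -> exists2 n, act_kernel n & h = mul_triple g n.
Proof. by move=> e; have := mem_coset h; rewrite -e => -[n kn <-]; exists n. Qed.

Lemma GL3_mul_kernel g n : act_kernel n -> GL3 g -> GL3 (mul_triple g n).
Proof.
move=> kn; have [n' kn' e] := act_kernelV kn.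
case: kn => la [mu] [nu] [e1 ->] [/= ga gb gc].
have : la * mu * nu != 0 by rewrite e1 oner_eq0.
rewrite !mulf_eq0 !negb_or => /andP[/andP[l0 m0] n0].
by split; rewrite /= mul_mx_scalar unitmxZ ?unitfE.
Qed.

Definition coset_set (P : set (mx_triple K m)) : set (set (mx_triple K m)) :=
  [set coset g | g in @GL3 K m `&` P].

Lemma coset_setE (P : set (mx_triple K m)) g :
  (forall h n, GL3 h -> act_kernel n -> P h -> P (mul_triple h n)) ->
  GL3 g -> coset_set P (coset g) <-> P g.
Proof.
move=> Psat Gg; split=> [[h [Gh Ph] /eq_coset[n kn ->]]|Pg]; first exact: Psat.
by exists g.
Qed.

Lemma zariski_closed_coset_set (P : set (mx_triple K m)) I :
  (forall h n, GL3 h -> act_kernel n -> P h -> P (mul_triple h n)) ->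
  (forall g, GL3 g -> P g <-> zero_locus I g) ->
  zariski_closed (coset_set P).
Proof.
move=> Psat PI; exists I; apply/seteqP; split => g [Gg Zg]; split => //.
  exact/(PI g Gg)/(coset_setE Psat Gg).
exact/(coset_setE Psat Gg)/(PI g Gg).
Qed.

Lemma zariski_closed_ratl (A : Type) (f : A -> mx_triple K m -> K) :
  (forall a, ratl (fun=> True) pt (f a)) ->
  (forall h n, GL3 h -> act_kernel n -> (forall a, f a h = 0) ->
     forall a, f a (mul_triple h n) = 0) ->
  zariski_closed (coset_set [set g | forall a, f a g = 0]).
Proof.
move=> rf fsat.
(* The equations are the numerators of the [f a], which have the same zeros since the denominators
   vanish nowhere. *)
apply: (zariski_closed_coset_set (I := [set P | exists a Q, forall g, True ->
    Q.@[pt g] != 0 /\ Q.@[pt g] * f a g = P.@[pt g]])) => // g Gg; split.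
  by move=> fg P [a [Q /(_ g I)[_ e]]]; rewrite -/(pt g) -e fg mulr0.
move=> H a; have [P [Q PQ]] := rf a.
have /eqP : P.@[pt g] = 0 by apply: H; exists a, Q.
by have [Q0 <-] := PQ g I; rewrite mulf_eq0 (negbTE Q0) => /eqP.
Qed.

Variables u v : mx_triple K m -> K.
Hypotheses (ru : ratl (fun=> True) pt u) (rv : ratl (fun=> True) pt v).
Hypothesis uE : forall g la mu nu,
  u (mul_triple g (scalar_triple la mu nu)) = la * u g.
Hypothesis vE : forall g la mu nu,
  v (mul_triple g (scalar_triple la mu nu)) = mu * v g.

(** The kernel is a two-dimensional torus, so [u = v = 1] selects one representative in each coset
    with [u v <> 0]; the third scalar is forced by the condition that the product be 1. *)
Definition normalize g := mul_triple g (scalar_triple (u g)^-1 (v g)^-1 (u g * v g)).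

Definition slice (F : set (set (mx_triple K m))) : set (mx_triple K m) :=
  [set g | [/\ GL3 g, F (coset g), u g = 1 & v g = 1]].

Lemma normalize_kernel g : u g * v g != 0 ->
  act_kernel (scalar_triple (u g)^-1 (v g)^-1 (u g * v g)).
Proof.
by move=> uv; exists (u g)^-1, (v g)^-1, (u g * v g); rewrite -invfM mulVf.
Qed.

Lemma slice_normalize (F : set (set (mx_triple K m))) g :
  GL3 g -> F (coset g) -> u g * v g != 0 -> slice F (normalize g).
Proof.
move=> Gg Fg uv; have kn := normalize_kernel uv.
split; rewrite /normalize ?coset_mul ?uE ?vE //; first exact: GL3_mul_kernel.
  by rewrite mulVf //; apply: contraNneq uv => ->; rewrite mul0r.
by rewrite mulVf //; apply: contraNneq uv => ->; rewrite mulr0.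
Qed.

Lemma normalize_slice F g : slice F g -> normalize g = g.
Proof.
move=> [_ _ u1 v1]; rewrite /normalize u1 v1 mul_scalar_triple.
by rewrite invr1 mulr1 !scale1r; case: (g) => -[].
Qed.

Lemma normalize_mul g n : act_kernel n -> u g * v g != 0 ->
  normalize (mul_triple g n) = normalize g.
Proof.
move=> [la [mu [nu [e ->]]]]; rewrite mulf_eq0 negb_or => /andP[u0 v0].
have : la * mu * nu != 0 by rewrite e oner_eq0.
rewrite !mulf_eq0 !negb_or => /andP[/andP[l0 m0] n0].
rewrite /normalize uE vE mul_scalar_triple [in LHS]/mul_triple /= !mul_mx_scalar.
rewrite mul_scalar_triple !scalerA; congr (_ *: _, _ *: _, _ *: _).
- by field; rewrite l0 u0.
- by field; rewrite m0 v0.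
- by rewrite -[RHS]mul1r -e; ring.
Qed.

(* Vanishing of [p] at the normalized representative is a closed condition on
   the chart [u v <> 0]; adding the locus [u v = 0] makes it closed everywhere. *)
Definition normalized_zeros (p : {mpoly K[N]}) : set (mx_triple K m) :=
  [set g | u g * v g != 0 -> p.@[pt (normalize g)] = 0].

Lemma normalized_zeros_saturated p g n : GL3 g -> act_kernel n ->
  normalized_zeros p g -> normalized_zeros p (mul_triple g n).
Proof.
move=> _ kn pg uv.
have uv0 : u g * v g != 0.
  case: kn uv => la [mu [nu [e ->]]]; rewrite uE vE.
  by apply: contraNneq => uv0; rewrite mulrACA uv0 mulr0.
by rewrite normalize_mul // pg.
Qed.

Lemma zariski_closed_normalized_zeros p :
  zariski_closed (coset_set (normalized_zeros p)).
Proof.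
pose D g := u g * v g != 0.
have D2 g : D g -> u g != 0 /\ v g != 0.
  by rewrite /D mulf_eq0 negb_or => /andP[].
have ruD := ratl_sub (fun g (_ : D g) => I) ru.
have rvD := ratl_sub (fun g (_ : D g) => I) rv.
have [P [Q PQ]] : ratl D pt (fun g => p.@[pt (normalize g)]).
  apply: ratl_meval => i.
  have ru' : ratl D pt (fun g => (u g)^-1) by apply: ratlV => // g /D2[].
  have rv' : ratl D pt (fun g => (v g)^-1) by apply: ratlV => // g /D2[].
  have ruv := ratlM ruD rvD.
  apply: ratl_coords.
  - apply: eq_ratl_mx (ratl_scalemx ru' (@ratl_entriesA D)) => g _.
    by rewrite /normalize mul_scalar_triple.
  - apply: eq_ratl_mx (ratl_scalemx rv' (@ratl_entriesB D)) => g _.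
    by rewrite /normalize mul_scalar_triple.
  - apply: eq_ratl_mx (ratl_scalemx ruv (@ratl_entriesC D)) => g _.
    by rewrite /normalize mul_scalar_triple.
(* Multiplying the numerator by [u v] gives one polynomial condition valid on and off the chart; the
   index type [unit] fits it to the family form of [zariski_closed_ratl]. *)
have E : normalized_zeros p = [set g | unit -> u g * v g * P.@[pt g] = 0].
  apply/seteqP; split => g pg.
    move=> _; have [->|uv] := eqVneq (u g * v g) 0; first by rewrite mul0r.
    by have [_ <-] := PQ g uv; rewrite pg // !mulr0.
  move=> uv; have /eqP := pg tt; have [Q0 <-] := PQ g uv.
  by rewrite !mulf_eq0 -mulf_eq0 (negbTE uv) (negbTE Q0) => /eqP.
rewrite E; apply: zariski_closed_ratl; last first.
  by move=> h n Gh kn; have := @normalized_zeros_saturated p h n Gh kn; rewrite E.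
move=> _; apply: ratlM (ratlM ru rv) _.
by apply: ratl_meval => i; apply: ratl_par.
Qed.

(** If a product vanishes on the slice, the closed sets given by its two factors cover [F]:
    normalizing a point of the chart lands in the slice, and points off the chart lie in both sets.
    Irreducibility then selects one factor. *)
Lemma prime_slice (F : set (set (mx_triple K m))) :
  F `<=` [set coset g | g in @GL3 K m] -> irreducible (@zariski_closed K m) F ->
  prime_on pt (slice F).
Proof.
move=> FGL [_ irrF] p q pq0.
have sub r : F `<=` coset_set (normalized_zeros r) -> vanishes_on pt (slice F) r.
  move=> Fr g sg; have [Gg Fg u1 v1] := sg.
  have /(coset_setE (@normalized_zeros_saturated r) Gg) := Fr _ Fg.
  rewrite /normalized_zeros /= (normalize_slice sg).
  by apply; rewrite u1 v1 mulr1 oner_eq0.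
have [] := irrF _ _ (zariski_closed_normalized_zeros p)
  (zariski_closed_normalized_zeros q).
- move=> c Fc; have [g Gg cg] := FGL c Fc; rewrite -cg in Fc *.
  have [uv0|uv] := eqVneq (u g * v g) 0.
    by left; exists g => //; split; rewrite // /normalized_zeros /= uv0 eqxx.
  have := pq0 _ (slice_normalize Gg Fc uv); rewrite mevalM => /eqP.
  rewrite mulf_eq0 => /orP[]/eqP e.
    by left; exists g => //; split => // _.
  by right; exists g => //; split => // _.
- by left; apply: sub.
- by right; apply: sub.
Qed.

(** The coset of [g0] lies in the smallest member and in the chart, so all members meet the chart,
    and strict inclusions between them persist on the slices. *)
Lemma chain_slice_indep (X : set (set (mx_triple K m))) (k : nat) F g0 :
  X `<=` [set coset g | g in @GL3 K m] ->
  irreducible_chain (@zariski_closed K m) X k F ->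
  GL3 g0 -> F 0%N (coset g0) -> u g0 * v g0 != 0 ->
  exists2 fs, size fs = k & forall s, alg_indep_below pt s (slice (F k)) fs.
Proof.
move=> XGL [clF ltF] Gg0 Fg0 uvg0.
have FX i : (i <= k)%N -> F i `<=` X by case/clF => -[Z [_ ->]] _ c [].
have FGL i : (i <= k)%N -> F i `<=` [set coset g | g in @GL3 K m].
  by move=> ile; apply: subset_trans (FX i ile) XGL.
have F0 i : (i <= k)%N -> F i (coset g0).
  elim: i => // i IH lt_in; have [le_i _] := ltF i lt_in.
  by apply: le_i; apply: IH; lia.
apply: (@chain_alg_indep _ _ _ pt k (fun i => slice (F i))).
- by exists (normalize g0); apply: slice_normalize.
- by move=> i ile; apply: prime_slice; [apply: FGL|have [] := clF i ile].
move=> i lt_in; have [subF nsubF] := ltF i lt_in.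
split; first by move=> g [Gg Fg u1 v1]; split => //; apply: subF.
apply: contrapT => nof; apply: nsubF.
have [[Z [clZ FZ]] _] := clF i (ltnW lt_in).
have [_ [_ irrF]] := clF i.+1 lt_in.
have [I IZ] := clZ.
(* [normalized_zeros 1] is the locus [u v = 0]. If no polynomial separated the slices, this locus
   and [Z] would cover [F i.+1]; containment in [Z] contradicts strictness, and [g0] excludes
   containment in the locus. *)
have [] := irrF _ _ clZ (zariski_closed_normalized_zeros 1).
- move=> c Fc; have [g Gg cg] := FGL _ lt_in c Fc; rewrite -cg in Fc *.
  have [uv0|uv] := eqVneq (u g * v g) 0.
    by right; exists g => //; split; rewrite // /normalized_zeros /= uv0 eqxx.
  left; have sg := slice_normalize Gg Fc uv.
  rewrite -(coset_mul g (normalize_kernel uv)) -/(normalize g).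
  have: (@GL3 K m `&` zero_locus I) (normalize g).
    split; first by case: sg.
    move=> f If; apply: contrapT => fg; apply: nof; exists f.
      move=> h [Gh Fh _ _]; rewrite FZ in Fh; case: Fh => _ Zh.
      by have : (@GL3 K m `&` @coset K m @^-1` Z) h by []; rewrite IZ => -[_]; apply.
    by move=> /(_ _ sg).
  by rewrite -IZ => -[].
- by rewrite FZ => FZ1 c Fc; split; [apply: (FX i.+1)|apply: FZ1].
- move=> /(_ _ (F0 _ lt_in)) /(coset_setE (@normalized_zeros_saturated 1) Gg0).
  by move=> /(_ uvg0) /eqP; rewrite meval1 oner_eq0.
Qed.

End Charts.

(** * Upper bound *)

Section Flattening.

Variables (K : fieldType) (m : nat).
Implicit Types (g : mx_triple K m) (T : tensor K m).

Definition layer T i : 'M[K]_m := \matrix_(j, l) T (i, j, l).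

Definition flat T : 'M[K]_(m, m * m) := \matrix_i mxvec (layer T i).

Lemma flat_inj : injective flat.
Proof.
move=> T T' e; apply/ffunP => -[[i j] l].
have := congr1 (fun M : 'M_(_, _) => M i (mxvec_index j l)) e.
by rewrite !mxE !mxvecE !mxE.
Qed.

Lemma flattening_AE T alpha : flattening_A T alpha = vec_mx (alpha *m flat T).
Proof.
apply/matrixP => j l; rewrite !mxE; apply: eq_bigr => i _.
by rewrite !mxE mxvecE !mxE.
Qed.

(** The action of [(b, c)] on the factor B (x) C, written on row vectors, so that the action on
    [flat T] becomes multiplication on both sides. *)
Definition kron (b c : 'M[K]_m) : 'M[K]_(m * m) :=
  lin_mx (mulmxr c^T \o mulmx b).

Lemma mul_mxvec_kron (M b c : 'M[K]_m) :
  mxvec M *m kron b c = mxvec (b *m M *m c^T).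
Proof. by rewrite mul_vec_lin. Qed.

Lemma ratl_kron X D d (par : X -> 'I_d -> K) (b c : X -> 'M[K]_m) :
  ratl_mx D par b -> ratl_mx D par c -> ratl_mx D par (fun x => kron (b x) (c x)).
Proof.
move=> rb rc i j.
pose E : 'M[K]_m := vec_mx (delta_mx 0 i).
have rE : ratl_mx D par (fun x => mxvec (b x *m E *m (c x)^T)).
  apply: ratl_mxvec; apply: ratl_mulmx (ratl_tr rc).
  by apply: ratl_mulmx => //; apply: ratl_mx_const.
apply: eq_ratl (rE 0 j) => x _.
by rewrite -mul_mxvec_kron vec_mxK -rowE mxE.
Qed.

Lemma actE g T r s t :
  act g T (r, s, t) = \sum_i g.1.1 r i * (g.1.2 *m layer T i *m g.2^T) s t.
Proof.
have mulE (M : 'M[K]_m) (i j : 'I_m) : (M *m basis_vec K i) j 0 = M j i.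
  by rewrite /basis_vec -colE mxE.
rewrite /act sum_ffunE; apply: eq_bigr => i _.
rewrite sum_ffunE mxE big_distrr /=.
under [RHS]eq_bigr => k _ do rewrite !mxE big_distrl big_distrr /=.
rewrite exchange_big; apply: eq_bigr => j _.
rewrite sum_ffunE; apply: eq_bigr => k _.
by rewrite !ffunE /= !mulE mxE /GRing.scale /=; ring.
Qed.

Lemma flat_act g T : flat (act g T) = g.1.1 *m flat T *m kron g.1.2 g.2.
Proof.
apply/matrixP => r p; case/mxvec_indexP: p => s t.
rewrite mxE mxvecE mxE actE -mulmxA mxE; apply: eq_bigr => i _.
congr (_ * _); rewrite -[LHS]mxvecE -mul_mxvec_kron.
have -> : mxvec (layer T i) = row i (flat T) by rewrite rowK.
by rewrite -row_mul [LHS]mxE.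
Qed.

(** Meant for a rank factorization [F = l t]: multiplying [A F z = F] by a right inverse of [t]
    leaves an equation on the column factor alone. *)
Lemma mulmx_factor q n r (A : 'M[K]_q) (F : 'M_(q, n)) (l : 'M_(q, r))
    (t : 'M_(r, n)) (z : 'M_n) (p : 'M_(n, r)) :
  l *m t = F -> A *m F *m z = F -> t *m p = 1%:M ->
  A *m l *m (t *m z *m p) = l.
Proof.
move=> <- e tp; rewrite -[RHS]mulmx1 -tp [RHS]mulmxA -[in RHS]e.
by rewrite !mulmxA.
Qed.

(** * Components of a symmetry as functions of the parameters *)

Section SymmetricTriples.

Variables (T : tensor K m) (alpha : 'rV[K]_m).
Hypothesis alphaU : flattening_A T alpha \in unitmx.

Notation F := (flat T).
Notation k := (\rank F).
Notation C := (col_ebase F).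
Notation L := (col_base F).
Notation R := (row_base F).

Lemma mulrow_baseV : R *m pinvmx R = 1%:M.
Proof. by rewrite mulmxVp // row_base_free. Qed.

Lemma symmetry_flat g : act g T = T -> g.1.1 *m F *m kron g.1.2 g.2 = F.
Proof. by move=> gT; rewrite -flat_act gT. Qed.

(** The columns of [L] span the A-support of [T]; on it the first component of a symmetry is
    determined by the other two. *)
Lemma symmetry_col_base g : GL3 g -> act g T = T ->
  R *m kron g.1.2 g.2 *m pinvmx R \in unitmx /\
  g.1.1 *m L = L *m invmx (R *m kron g.1.2 g.2 *m pinvmx R).
Proof.
move=> [/= ga gb gc] /symmetry_flat e; set x := R *m _ *m _.
have e1 : g.1.1 *m L *m x = L.
  exact: mulmx_factor (mulmx_base F) e mulrow_baseV.
have xU : x \in unitmx.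
  (* [L] has rank [k] and is a product with right factor [x], which forces full rank on [x]. *)
  rewrite -row_full_unit /row_full eqn_leq rank_leq_row /=.
  by rewrite -[X in (X <= _)%N](eqP (col_base_full F)) -{1}e1 mxrankM_maxr.
by rewrite -[in RHS]e1 -mulmxA mulmxV // mulmx1.
Qed.

(** The matrix inverted here is [T_A (alpha gA)], written through the rank factorization so that
    only the [k] entries of [alpha gA L] enter. *)
Lemma symmetry_C g : GL3 g -> act g T = T ->
  vec_mx (alpha *m (g.1.1 *m L) *m R) \in unitmx /\
  g.2^T = invmx (vec_mx (alpha *m (g.1.1 *m L) *m R)) *m invmx g.1.2 *m flattening_A T alpha.
Proof.
move=> [ga gb gc] gT; set M := vec_mx _; rewrite /=.
have e : g.1.2 *m M *m g.2^T = flattening_A T alpha.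
  apply/(can_inj mxvecK); rewrite -mul_mxvec_kron vec_mxK.
  rewrite flattening_AE vec_mxK -[in RHS](symmetry_flat gT).
  by rewrite -[_ *m R]mulmxA -[_ *m L *m R]mulmxA mulmx_base !mulmxA.
have MU : M \in unitmx by move: alphaU; rewrite -e !unitmx_mul => /andP[/andP[]].
by rewrite -e !mulmxA mulmxKV // mulVmx // mul1mx.
Qed.

Variables (D : mx_triple K m -> Prop) (d : nat) (par : mx_triple K m -> 'I_d -> K).
Hypothesis DT : forall g, D g -> GL3 g /\ act g T = T.
Hypothesis rB : ratl_mx D par (fun g => g.1.2).
Hypothesis r_alpha : forall j : 'I_m, (j < k)%N ->
  ratl D par (fun g => (alpha *m (g.1.1 *m C)) 0 j).
Hypothesis rA_high : forall i j : 'I_m, (k <= j)%N ->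
  ratl D par (fun g => (g.1.1 *m C) i j).

(** [L] consists of the first [k] columns of [C], so the entries of [alpha gA L] needed in
    [symmetry_C] are those supplied by [r_alpha]. *)
Lemma symmetry_ratl_C : ratl_mx D par (fun g => g.2).
Proof.
have rL : ratl_mx D par (fun g => alpha *m (g.1.1 *m L)).
  move=> i j; rewrite (ord1 i).
  have rs : ratl D par (fun g => \sum_l (alpha *m (g.1.1 *m C)) 0 l *
      (pid_mx k : 'M_(m, k)) l j).
    apply: ratl_sum => l; have [lk|kl] := ltnP l k.
      by apply: ratlM (ratl_const _ _ _); apply: r_alpha.
    apply: eq_ratl (ratl_const _ _ 0) => g _.
    by rewrite [pid_mx _ _ _]mxE ltnNge kl andbF mulr0.
  by apply: eq_ratl rs => g _; rewrite /col_base !mulmxA [in RHS]mxE -!mulmxA.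
have rM : ratl_mx D par (fun g => vec_mx (alpha *m (g.1.1 *m L) *m R)).
  by apply: ratl_vec_mx; apply: ratl_mulmx rL (ratl_mx_const _ _ _).
have rMV := ratl_invmx (fun g Dg => (symmetry_C (DT Dg).1 (DT Dg).2).1) rM.
have rBV : ratl_mx D par (fun g => invmx g.1.2).
  by apply: ratl_invmx rB => g /DT[[]].
have rCT := ratl_mulmx (ratl_mulmx rMV rBV) (ratl_mx_const _ _ (flattening_A T alpha)).
apply: eq_ratl_mx (ratl_tr rCT) => g Dg.
by rewrite -(symmetry_C (DT Dg).1 (DT Dg).2).2 trmxK.
Qed.

(** The first [k] columns of [gA C] come from [gB] and [gC] by [symmetry_col_base]; the others are
    rational by [rA_high]. Multiplying by the inverse of [C] recovers [gA]. *)
Lemma symmetry_ratl_A : ratl_mx D par (fun g => g.1.1).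
Proof.
pose x g : 'M_k := R *m kron g.1.2 g.2 *m pinvmx R.
have rx : ratl_mx D par x.
  apply: ratl_mulmx (ratl_mx_const _ _ _).
  apply: ratl_mulmx (ratl_mx_const _ _ _) _.
  by apply: ratl_kron => //; apply: symmetry_ratl_C.
have xU g : D g -> x g \in unitmx.
  by move=> /DT[Gg gT]; have [] := symmetry_col_base Gg gT.
have rL : ratl_mx D par (fun g => g.1.1 *m L).
  have rY := ratl_mulmx (ratl_mx_const _ _ L) (ratl_invmx xU rx).
  apply: eq_ratl_mx rY => g /DT[Gg gT].
  by have [_ ->] := symmetry_col_base Gg gT.
have rAC : ratl_mx D par (fun g => g.1.1 *m C).
  move=> i j; have [jk|kj] := ltnP j k; last exact: rA_high.
  apply: eq_ratl (rL i (Ordinal jk)) => g _.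
  have -> : g.1.1 *m L = (g.1.1 *m C) *m pid_mx k by rewrite -mulmxA.
  rewrite mxE (bigD1 j) //= [pid_mx _ _ _]mxE eqxx jk mulr1.
  rewrite big1 ?addr0 // => l lj; rewrite [pid_mx _ _ _]mxE.
  by rewrite [_ == _](negbTE lj) mulr0.
apply: eq_ratl_mx (ratl_mulmx rAC (ratl_mx_const _ _ (invmx C))) => g _.
by rewrite mulmxK // col_ebase_unit.
Qed.

End SymmetricTriples.

End Flattening.

Lemma card_ord_lt m k : (k <= m)%N -> #|[pred j : 'I_m | (j < k)%N]| = k.
Proof.
by move=> km; rewrite -sum1_card -(big_ord_widen m (fun=> 1%N) km) sum1_card card_ord.
Qed.

Lemma card_ord_ge m k : (k <= m)%N -> #|[pred j : 'I_m | (k <= j)%N]| = (m - k)%N.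
Proof.
move=> km; have := cardC [pred j : 'I_m | (j < k)%N].
rewrite card_ord_lt // card_ord => e; rewrite -[in RHS]e addKn.
by apply: eq_card => j; rewrite !inE -leqNgt.
Qed.

Lemma ratl_finite_par (K : fieldType) X (D : X -> Prop) (J : finType)
    (p : J -> X -> K) a :
  ratl D (fun x (i : 'I_#|J|) => p (enum_val i) x) (p a).
Proof.
by apply: eq_ratl (ratl_par D _ (enum_rank a)) => x _; rewrite enum_rankK.
Qed.

(** * Parameter count and the bound on chains *)

Section UpperBound.

Local Open Scope classical_set_scope.

Variables (K : fieldType) (m : nat) (m_gt0 : (0 < m)%N).
Variables (T : tensor K m) (alpha : 'rV[K]_m).
Hypothesis alphaU : flattening_A T alpha \in unitmx.

Notation k := (\rank (flat T)).
Notation C := (col_ebase (flat T)).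

Lemma unitmx_neq0 (M : 'M[K]_m) : M \in unitmx -> M != 0.
Proof.
move=> MU; apply/eqP => M0; have := mulVmx MU; rewrite M0 mulmx0.
move/matrixP/(_ (Ordinal m_gt0) (Ordinal m_gt0))/eqP.
by rewrite !mxE eqxx eq_sym oner_eq0.
Qed.

(** Supplies the coordinate used as [u] in the chart. If all of them vanished, so would
    [T_A (alpha gA)], which is invertible. *)
Lemma alpha_coord_neq0 g : GL3 g -> act g T = T ->
  exists2 j : 'I_m, (j < k)%N & (alpha *m (g.1.1 *m C)) 0 j != 0.
Proof.
move=> Gg gT; have [MU _] := symmetry_C alphaU Gg gT.
have /matrix0Pn[i [j]] : alpha *m (g.1.1 *m col_base (flat T)) != 0.
  by apply: contraTneq MU => ->; rewrite mul0mx linear0; apply/negP => /unitmx_neq0/eqP.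
rewrite (ord1 i) => ne0; exists (widen_ord (rank_leq_row _) j); first exact: (ltn_ord j).
apply: contraNneq ne0 => e0.
have -> : alpha *m (g.1.1 *m col_base (flat T)) = alpha *m (g.1.1 *m C) *m pid_mx k.
  by rewrite -!mulmxA.
rewrite mxE (bigD1 (widen_ord (rank_leq_row _) j)) //= e0 mul0r.
rewrite big1 ?addr0 // => l lj; rewrite [pid_mx _ _ _]mxE.
rewrite -[nat_of_ord j]/(nat_of_ord (widen_ord (rank_leq_row (flat T)) j)).
by rewrite [_ == _](negbTE lj) mulr0.
Qed.

Lemma slice_dim_le (u v : mx_triple K m -> K) (j0 : 'I_m) (b : 'I_m * 'I_m) F fs :
  (forall g, u g = (alpha *m (g.1.1 *m C)) 0 j0) -> (j0 < k)%N ->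
  (forall g, v g = g.1.2 b.1 b.2) ->
  F `<=` symmetry_group T ->
  (forall s, alg_indep_below (@pt K m) s (slice u v F) fs) ->
  ((size fs).+2 <= k + m * (m - k) + m * m)%N.
Proof.
move=> uE j0k vE FT ind.
(* The parameters are the first [k] coordinates of [alpha gA C] except [u], the last [m - k] columns
   of [gA C], and the entries of [gB] except [v]. The two omitted functions equal 1 on the slice. *)
pose J1 : finType := {j : 'I_m | (j < k)%N && (j != j0)}.
pose J2 : finType := ('I_m * {j : 'I_m | (k <= j)%N})%type.
pose J3 : finType := {p : 'I_m * 'I_m | p != b}.
pose J : finType := (J1 + J2 + J3)%type.
have km : (k <= m)%N := rank_leq_row _.
have cardJ1 : #|J1|.+1 = k.
  have := cardD1 j0 [pred j : 'I_m | (j < k)%N]; rewrite card_ord_lt // inE j0k => ->.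
  by rewrite card_sig; congr _.+1; apply: eq_card => j; rewrite !inE andbC.
have cardJ3 : #|J3|.+1 = (m * m)%N.
  have -> : #|J3| = #|predC1 b|.
    by rewrite card_sig; apply: eq_card => p; rewrite !inE.
  by rewrite cardC1 card_prod card_ord prednK // muln_gt0 m_gt0.
have cardJ2 : #|J2| = (m * (m - k))%N.
  by rewrite card_prod card_ord card_sig card_ord_ge.
have cardJ : #|J|.+2 = (k + m * (m - k) + m * m)%N.
  rewrite 2!card_sum cardJ2.
  by rewrite -addSn -addnS cardJ3 -!addSn cardJ1.
pose p (a : J) (g : mx_triple K m) : K := match a with
  | inl (inl j) => (alpha *m (g.1.1 *m C)) 0 (val j)
  | inl (inr (i, j)) => (g.1.1 *m C) i (val j)
  | inr c => g.1.2 (val c).1 (val c).2 end.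
pose D g := [/\ GL3 g, act g T = T, u g = 1 & v g = 1].
pose par g (i : 'I_#|J|) := p (enum_val i) g.
have rB : ratl_mx D par (fun g => g.1.2).
  move=> i j; have [e|ne] := eqVneq (i, j) b.
    by apply: eq_ratl (ratl_const _ _ 1) => g [_ _ _ <-]; rewrite vE -e.
  exact: (ratl_finite_par D p (inr (exist _ (i, j) ne))).
have r_alpha (j : 'I_m) : (j < k)%N ->
    ratl D par (fun g => (alpha *m (g.1.1 *m C)) 0 j).
  move=> jk; have [->|ne] := eqVneq j j0.
    by apply: eq_ratl (ratl_const _ _ 1) => g [_ _ <- _]; rewrite uE.
  have jP : (j < k)%N && (j != j0) by rewrite jk.
  exact: (ratl_finite_par D p (inl (inl (exist _ j jP)))).
have rA_high (i j : 'I_m) : (k <= j)%N -> ratl D par (fun g => (g.1.1 *m C) i j).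
  by move=> kj; apply: (ratl_finite_par D p (inl (inr (i, exist _ j kj)))).
have DT g : D g -> GL3 g /\ act g T = T by case.
have rz i : ratl D par (fun g => pt g i).
  apply: ratl_coords => //; first exact: (symmetry_ratl_A alphaU DT).
  exact: (symmetry_ratl_C alphaU DT).
rewrite -cardJ !ltnS; apply: (alg_indep_le rz _ ind) => g [Gg Fg u1 v1].
split=> //; have [h [Gh hT] e] := FT _ Fg.
have hg : coset h g by rewrite e; apply: mem_coset.
by rewrite (act_coset T hg).
Qed.

Lemma symmetry_chain_le n F :
  irreducible_chain (@zariski_closed K m) (symmetry_group T) n F ->
  (n.+2 <= k + m * (m - k) + m * m)%N.
Proof.
move=> chF; have [clF ltF] := chF.
(* The chart is chosen around a point of the smallest member of the chain. *)
have [[Z [_ F0E]] [[c0 Fc0] _]] := clF 0%N isT.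
have [g0 [Gg0 g0T] e0] : symmetry_group T c0 by move: Fc0; rewrite F0E => -[].
have [j0 j0k u0] := alpha_coord_neq0 Gg0 g0T.
have /matrix0Pn[b1 [b2 v0]] : g0.1.2 != 0 by case: Gg0 => _ /unitmx_neq0.
pose u (g : mx_triple K m) := (alpha *m (g.1.1 *m C)) 0 j0.
pose v (g : mx_triple K m) := g.1.2 b1 b2.
have ru : ratl (fun=> True) (@pt K m) u.
  by apply: (ratl_mulmx (ratl_mx_const _ _ alpha)
    (ratl_mulmx (@ratl_entriesA K m (fun=> True)) (ratl_mx_const _ _ C))).
have rv : ratl (fun=> True) (@pt K m) v by apply: ratl_entriesB.
have uE g la mu nu : u (mul_triple g (scalar_triple m la mu nu)) = la * u g.
  by rewrite /u mul_scalar_triple /= -scalemxAl -scalemxAr mxE.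
have vE g la mu nu : v (mul_triple g (scalar_triple m la mu nu)) = mu * v g.
  by rewrite /v mul_scalar_triple /= mxE.
have XGL : symmetry_group T `<=` [set coset g | g in @GL3 K m].
  by move=> c [g [Gg _] <-]; exists g.
have Fg0 : F 0%N (coset g0) by rewrite e0.
have uv0 : u g0 * v g0 != 0 by rewrite mulf_neq0.
have [fs sz ind] := chain_slice_indep ru rv uE vE XGL chF Gg0 Fg0 uv0.
rewrite -sz; apply: (@slice_dim_le u v j0 (b1, b2) (F n) fs _ _ _ _ ind) => //.
by have [[Z' [_ ->]] _] := clF n (leqnn n) => c [].
Qed.

(* Nonvanishing on a line *)
End UpperBound.

Section UnivariateNonvanishing.

Variable K : numFieldType.

(** In characteristic 0 the first [size p] naturals are distinct in [K], and they outnumber the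
    roots of [p]. *)
Lemma poly_nonroot (p : {poly K}) : p != 0 -> exists t, p.[t] != 0.
Proof.
move=> p0; apply: contrapT => allroot.
have roots : all (root p) [seq i%:R | i <- iota 0 (size p)].
  apply/allP => x _; apply/negPn/negP => nx.
  by apply: allroot; exists x.
have uniq_roots : uniq [seq (i%:R : K) | i <- iota 0 (size p)].
  rewrite map_inj_uniq ?iota_uniq // => i j /eqP.
  by rewrite eqr_nat => /eqP.
by have := max_poly_roots p0 roots uniq_roots; rewrite size_map size_iota ltnn.
Qed.

Definition line_par (t : K) : 'I_1 -> K := fun=> t.

Lemma meval_line (P : {mpoly K[1]}) :
  exists p : {poly K}, forall t, P.@[line_par t] = p.[t].
Proof.
exists (\sum_(e <- msupp P) P@_e *: 'X^(e 0)) => t.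
rewrite mevalE horner_sum; apply: eq_bigr => e _.
by rewrite big_ord1 hornerZ hornerXn.
Qed.

(** This is the irreducibility of a nonempty open subset of the line: each condition is the
    nonvanishing of a one-variable polynomial, and a product of three nonzero polynomials has a
    nonroot. *)
Lemma ratl_line_common_nonzero D (d h1 h2 : K -> K) t1 t2 :
  (forall t, D t <-> d t != 0) ->
  ratl (fun=> True) line_par d -> ratl D line_par h1 -> ratl D line_par h2 ->
  D t1 -> h1 t1 != 0 -> D t2 -> h2 t2 != 0 ->
  exists t, [/\ D t, h1 t != 0 & h2 t != 0].
Proof.
move=> DE [P [Q PQ]] [P1 [Q1 PQ1]] [P2 [Q2 PQ2]] Dt1 h1t Dt2 h2t.
have [[p pE] [p1 p1E] [p2 p2E]] :=
  And3 (meval_line P) (meval_line P1) (meval_line P2).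
have neq0 (q : {poly K}) t : q.[t] != 0 -> q != 0.
  by apply: contraNneq => ->; rewrite horner0.
have dp t : (d t != 0) = (p.[t] != 0).
  by have [Q0 e] := PQ t I; rewrite -pE -e mulf_eq0 (negbTE Q0).
have hp1 t : D t -> (h1 t != 0) = (p1.[t] != 0).
  by move=> Dt; have [Q0 e] := PQ1 t Dt; rewrite -p1E -e mulf_eq0 (negbTE Q0).
have hp2 t : D t -> (h2 t != 0) = (p2.[t] != 0).
  by move=> Dt; have [Q0 e] := PQ2 t Dt; rewrite -p2E -e mulf_eq0 (negbTE Q0).
have [|t] := @poly_nonroot (p * p1 * p2).
  rewrite !mulf_neq0 //.
  - by apply: (neq0 _ t1); rewrite -dp; apply/DE.
  - by apply: (neq0 _ t1); rewrite -hp1.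
  - by apply: (neq0 _ t2); rewrite -hp2.
rewrite !hornerM !mulf_eq0 !negb_or -dp => /andP[/andP[/DE Dt pt1] pt2].
by exists t; rewrite hp1 // hp2.
Qed.

(** The square of [delta_mx p q] is itself if [p = q] and 0 otherwise, so an inverse is
    [1 - c *: delta_mx p q] with [c] equal to 1/2 or 1. *)
Lemma unitmx_1_delta n (p q : 'I_n) : (1%:M + delta_mx p q : 'M[K]_n) \in unitmx.
Proof.
pose c : K := (1 + (q == p)%:R)^-1.
have c1 : c * (1 + (q == p)%:R) = 1.
  by rewrite mulVf // gt_eqF // ltr_pwDl ?ler0n ?ltr01.
suff /mulmx1_unit[] : (1%:M + delta_mx p q) *m (1%:M - c *: delta_mx p q) = 1%:M by [].
rewrite mulmxBr mulmx1 -scalemxAr mulmxDl mul1mx mul_delta_mx_cond.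
rewrite -[_ *+ (q == p)]scaler_nat -[X in X + _ *: _]scale1r -scalerDl scalerA.
by rewrite c1 scale1r addrK.
Qed.

End UnivariateNonvanishing.

(** * The standard tensor, its stabilizer and its orbit *)

Section StandardTensor.

Variables (K : fieldType) (m : nat) (m_gt0 : (0 < m)%N).

Notation o := (Ordinal m_gt0).
Notation T0 := (tensor_T0 K m_gt0).

Lemma tensor_T0E i j l : T0 (i, j, l) = (i == o)%:R * (j == l)%:R.
Proof.
rewrite /tensor_T0 sum_ffunE (bigD1 j) //= big1 => [|r rj].
  by rewrite !ffunE /= !mxE !eqxx !andbT addr0 mulr1 [l == j]eq_sym.
by rewrite !ffunE /= !mxE [j == r]eq_sym (negbTE rj) /= mulr0 mul0r.
Qed.

Lemma layer_T0 i : layer T0 i = (i == o)%:R%:M.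
Proof.
by apply/matrixP => j l; rewrite !mxE tensor_T0E -[RHS]mulr_natr.
Qed.

Lemma act_T0E (g : mx_triple K m) r s t :
  act g T0 (r, s, t) = g.1.1 r o * (g.1.2 *m g.2^T) s t.
Proof.
rewrite actE (bigD1 o) //= big1 ?addr0.
  by rewrite layer_T0 eqxx mulmx1.
by move=> i /negbTE io; rewrite layer_T0 io mulr0n raddf0 mulmx0 mul0mx mxE mulr0.
Qed.

(** As [T0] is [a_1] tensor the identity matrix, its image is [gA a_1] tensor [gB gC^T]. The second
    factor is nonzero, so comparing entries forces [gA a_1] to be a multiple of [a_1]. *)
Lemma symmetry_T0P (g : mx_triple K m) : GL3 g ->
  act g T0 = T0 <->
  (forall r, r != o -> g.1.1 r o = 0) /\ g.1.1 o o *: (g.1.2 *m g.2^T) = 1%:M.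
Proof.
move=> [/= _ gb gc]; split=> [gT|[gA gBC]].
  have e r s t : g.1.1 r o * (g.1.2 *m g.2^T) s t = (r == o)%:R * (s == t)%:R.
    by rewrite -act_T0E gT tensor_T0E.
  split=> [r ro|]; last first.
    by apply/matrixP => s t; rewrite mxE e eqxx mul1r mxE.
  have /(unitmx_neq0 m_gt0)/matrix0Pn[s [t st]] : g.1.2 *m g.2^T \in unitmx.
    by rewrite unitmx_mul gb unitmx_tr.
  by have /eqP := e r s t; rewrite (negbTE ro) mul0r mulf_eq0 (negbTE st) orbF => /eqP.
apply/ffunP => -[[r s] t]; rewrite act_T0E tensor_T0E.
have [->|ro] := eqVneq r o; last by rewrite gA // !mul0r.
by have /matrixP/(_ s t) := gBC; rewrite !mxE => ->; rewrite mul1r.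
Qed.

(** Rank 1 means that [T] is a vector tensor a matrix [M], and [M] is invertible because
    [T_A (alpha)] is a multiple of it. One moves the vector to [a_1] and [M] to the identity. *)
Lemma rank1_isomorphic (T : tensor K m) alpha :
  flattening_A T alpha \in unitmx -> \rank (flat T) = 1%N -> isomorphic T T0.
Proof.
move=> aU rk; pose C := col_ebase (flat T).
pose P : 'M_(m, m * m) := pid_mx 1 *m row_ebase (flat T).
have CU : C \in unitmx by apply: col_ebase_unit.
have TE : flat T = C *m P by rewrite /P mulmxA -rk mulmx_ebase.
have Prow r : r != o -> row r P = 0.
  move=> ro; rewrite row_mul; apply/eqP; rewrite (_ : row r _ = 0) ?mul0mx //.
  apply/rowP => j; rewrite !mxE ltnS leqn0.
  by case: eqP => // _; rewrite -[_ == 0%N]/(r == o :> nat) [_ == _](negbTE ro).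
have ME : flattening_A T alpha = (alpha *m C) 0 o *: vec_mx (row o P).
  rewrite flattening_AE TE mulmxA mulmx_sum_row (bigD1 o) //= big1 ?addr0.
    by rewrite linearZ.
  by move=> r ro; rewrite Prow // scaler0.
set M := vec_mx _ in ME.
have MU : M \in unitmx.
  by move: aU; rewrite ME unitmxE detZ unitrM => /andP[_]; rewrite -unitmxE.
exists (invmx C, invmx M, 1%:M); first by split; rewrite /= ?unitmx_inv ?unitmx1.
apply: flat_inj; rewrite flat_act /= TE mulKmx //; apply/row_matrixP => r.
rewrite row_mul rowK layer_T0.
have [->|ro] := eqVneq r o; last by rewrite Prow // mul0mx mulr0n !raddf0.
by rewrite -[row o P]vec_mxK mul_mxvec_kron mulVmx // mul1mx trmx1.
Qed.

End StandardTensor.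

(** * A chain of maximal length *)

Section LowerBound.

Local Open Scope classical_set_scope.

Variables (K : numFieldType) (m : nat) (m_gt0 : (0 < m)%N).
Implicit Types g w : mx_triple K m.

Notation o := (Ordinal m_gt0).
Notation T0 := (tensor_T0 K m_gt0).
Notation pos := ('I_m * 'I_m + 'I_m * 'I_m)%type.

Variables (T : tensor K m) (h : mx_triple K m).
Hypotheses (hG : GL3 h) (hT : act h T = T0).

Definition inv_triple g : mx_triple K m := (invmx g.1.1, invmx g.1.2, invmx g.2).

(** Conjugation by [h] carries the stabilizer of [T] to that of [T0]. The chain is built in the
    symmetry group of [T] itself, with its conditions imposed after this conjugation. *)
Definition transport g := mul_triple h (mul_triple g (inv_triple h)).
Definition transport_back w := mul_triple (inv_triple h) (mul_triple w h).

Lemma transport_backK : cancel transport_back transport.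
Proof.
case: hG => ha hb hc [[a b] c]; rewrite /transport /transport_back /mul_triple /=.
by rewrite !mulmxA !mulmxV // !mul1mx !mulmxK.
Qed.

Lemma transportK : cancel transport transport_back.
Proof.
case: hG => ha hb hc [[a b] c]; rewrite /transport /transport_back /mul_triple /=.
by rewrite !mulmxA !mulVmx // !mul1mx !mulmxKV.
Qed.

Lemma GL3_conj g : GL3 g -> GL3 (transport g).
Proof.
by case: hG => ha hb hc [ga gb gc]; split;
  rewrite /= !unitmx_mul unitmx_inv ?ha ?hb ?hc ?ga ?gb ?gc.
Qed.

Lemma GL3_unconj w : GL3 w -> GL3 (transport_back w).
Proof.
by case: hG => ha hb hc [ga gb gc]; split;
  rewrite /= !unitmx_mul unitmx_inv ?ha ?hb ?hc ?ga ?gb ?gc.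
Qed.

Lemma act_unconj w : act w T0 = T0 -> act (transport_back w) T = T.
Proof.
move=> wT; rewrite /transport_back !act_mul hT wT -hT -act_mul.
apply: act_kernel_trivial; exists 1, 1, 1; rewrite !mulr1; split=> //.
by case: hG => ha hb hc; rewrite /mul_triple /= !mulVmx.
Qed.

Lemma act_conj g : act g T = T -> act (transport g) T0 = T0.
Proof.
move=> gT; rewrite /transport !act_mul -{1}hT -(act_mul (inv_triple h)).
suff -> : act (mul_triple (inv_triple h) h) T = T by rewrite gT hT.
apply: act_kernel_trivial; exists 1, 1, 1; rewrite !mulr1; split=> //.
by case: hG => ha hb hc; rewrite /mul_triple /= !mulVmx.
Qed.

Lemma conj_scalar g la mu nu :
  transport (mul_triple g (scalar_triple m la mu nu)) =
  mul_triple (transport g) (scalar_triple m la mu nu).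
Proof.
rewrite !mul_scalar_triple /transport /mul_triple /=.
by rewrite -!scalemxAl -!scalemxAr.
Qed.

(** Defects are linear in the entries, so their vanishing persists along lines; the kernel only
    rescales them, so it is a condition on cosets. *)
Definition defect (a : pos) g : K :=
  match a with
  | inl p => g.1.1 p.1 p.2 - (p.1 == p.2)%:R * g.1.1 o o
  | inr p => g.1.2 p.1 p.2 - (p.1 == p.2)%:R * g.1.2 o o
  end.

(* Away from the positions in [S], the first two components of [g] are scalar
   matrices. *)
Definition within (S : seq pos) g : Prop := forall a, a \notin S -> defect a g = 0.

Definition stratum (S : seq pos) : set (set (mx_triple K m)) :=
  coset_set [set g | act g T = T /\ within S (transport g)].

Lemma within_mul S g n : act_kernel n -> within S g -> within S (mul_triple g n).
Proof.
move=> [la [mu [nu [e ->]]]] gS a aS.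
have := gS a aS; rewrite mul_scalar_triple; case: a {aS} => p /= e0; rewrite !mxE.
  by rewrite mulrCA -mulrBr e0 mulr0.
by rewrite mulrCA -mulrBr e0 mulr0.
Qed.

Lemma within_conj_mul S g n : act_kernel n ->
  within S (transport g) -> within S (transport (mul_triple g n)).
Proof.
move=> kn gS; have [la [mu [nu [_ e]]]] := kn.
by rewrite e conj_scalar; apply: within_mul; rewrite // /scalar_triple -e.
Qed.

Lemma stratum_coset S g : GL3 g ->
  stratum S (coset g) <-> act g T = T /\ within S (transport g).
Proof.
move=> Gg; apply: coset_setE => // k n _ kn [kT kS].
by split; [rewrite act_mul (act_kernel_trivial _ kn)|apply: within_conj_mul].
Qed.

Lemma stratum_closed S : closed_in (@zariski_closed K m) (symmetry_group T) (stratum S).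
Proof.
pose f (a : {a : pos | a \notin S}) g := defect (val a) (transport g).
have fE g : (forall a, f a g = 0) <-> within S (transport g).
  by split=> [fg a aS|gS [a aS]]; [exact: (fg (exist _ a aS))|exact: gS].
exists (coset_set [set g | forall a, f a g = 0]); split.
  apply: zariski_closed_ratl; last first.
    by move=> g n Gg kn /fE gS; apply/fE; apply: within_conj_mul.
  have rA : ratl_mx (fun=> True) (@pt K m) (fun g => (transport g).1.1).
    apply: ratl_mulmx (ratl_mx_const _ _ _) _.
    exact: ratl_mulmx (@ratl_entriesA K m _) (ratl_mx_const _ _ _).
  have rB : ratl_mx (fun=> True) (@pt K m) (fun g => (transport g).1.2).
    apply: ratl_mulmx (ratl_mx_const _ _ _) _.
    exact: ratl_mulmx (@ratl_entriesB K m _) (ratl_mx_const _ _ _).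
  case=> -[] [p q] aS.
    apply: eq_ratl (ratlD (rA p q) (ratlM (ratl_const _ _ (- (p == q)%:R)) (rA o o))).
    by move=> g _; rewrite /f /= mulNr.
  apply: eq_ratl (ratlD (rB p q) (ratlM (ratl_const _ _ (- (p == q)%:R)) (rB o o))).
  by move=> g _; rewrite /f /= mulNr.
apply/seteqP; split=> [c [g [Gg [gT gS]] <-]|c [[g [Gg gT] <-] [g' [Gg' /fE g'S] e]]].
  by split; [exists g|exists g => //; split => //; apply/fE].
exists g => //; split=> //; split => //.
by have [n kn ->] := eq_coset e; apply: within_conj_mul.
Qed.

Lemma stratum_id S : stratum S (coset (scalar_triple m 1 1 1)).
Proof.
have k1 : act_kernel (scalar_triple m 1 1 1 : mx_triple K m).
  by exists 1, 1, 1; rewrite !mulr1.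
exists (scalar_triple m 1 1 1) => //; split.
  by split; rewrite /= unitmx1.
split; first exact: act_kernel_trivial.
have -> : transport (scalar_triple m 1 1 1) = scalar_triple m 1 1 1.
  by case: hG => ha hb hc; rewrite /transport /mul_triple /= !mul1mx !mulmxV.
by case=> -[p q] _ /=; rewrite !mxE eqxx mulr1 subrr.
Qed.

Section Line.

Variables g1 g2 : mx_triple K m.

Definition lineA t := (1 - t) *: g1.1.1 + t *: g2.1.1.
Definition lineB t := (1 - t) *: g1.1.2 + t *: g2.1.2.
Definition det_line t := lineA t o o * (\det (lineA t) * \det (lineB t)).

(* The triples through [g1] and [g2] whose first two components move on a
   line and whose third component is the one forced by [symmetry_T0P]. *)
Definition line_triple t : mx_triple K m :=
  (lineA t, lineB t, ((lineA t o o)^-1 *: invmx (lineB t))^T).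

Hypotheses (g1G : GL3 g1) (g2G : GL3 g2).
Hypotheses (g1T : act g1 T0 = T0) (g2T : act g2 T0 = T0).

Lemma ratl_line D (M N : 'M[K]_m) :
  ratl_mx D (@line_par K) (fun t => (1 - t) *: M + t *: N).
Proof.
have rt : ratl D (@line_par K) id := ratl_par D (@line_par K) 0.
have r1t : ratl D (@line_par K) (fun t => 1 - t).
  apply: eq_ratl (ratlD (ratl_const _ _ 1) (ratlM (ratl_const _ _ (-1)) rt)).
  by move=> t _; rewrite mulN1r.
exact: ratl_addmx (ratl_scalemx r1t (ratl_mx_const _ _ M))
  (ratl_scalemx rt (ratl_mx_const _ _ N)).
Qed.

Lemma ratl_det_line : ratl (fun=> True) (@line_par K) det_line.
Proof.
have rA := ratl_line (fun=> True) g1.1.1 g2.1.1.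
have rB := ratl_line (fun=> True) g1.1.2 g2.1.2.
exact: ratlM (rA o o) (ratlM (ratl_det rA) (ratl_det rB)).
Qed.

Lemma det_line_neq0 t : det_line t != 0 ->
  [/\ lineA t o o != 0, lineA t \in unitmx & lineB t \in unitmx].
Proof. by rewrite /det_line !mulf_eq0 !negb_or !unitmxE !unitfE => /and3P. Qed.

Lemma ratl_line_triple p :
  ratl (fun t => det_line t != 0) (@line_par K)
    (fun t => p.@[pt (transport_back (line_triple t))]).
Proof.
set D := fun t => _.
have rA := ratl_line D g1.1.1 g2.1.1.
have rB := ratl_line D g1.1.2 g2.1.2.
have rlaV : ratl D (@line_par K) (fun t => (lineA t o o)^-1).
  by apply: ratlV (rA o o) => t /det_line_neq0[].
have rBV : ratl_mx D (@line_par K) (fun t => invmx (lineB t)).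
  by apply: ratl_invmx rB => t /det_line_neq0[].
have rC := ratl_tr (ratl_scalemx rlaV rBV).
have rconj (M N : 'M[K]_m) X : ratl_mx D (@line_par K) X ->
    ratl_mx D (@line_par K) (fun t => M *m (X t *m N)).
  move=> rX; apply: ratl_mulmx (ratl_mx_const _ _ _) _.
  exact: ratl_mulmx rX (ratl_mx_const _ _ _).
by apply: ratl_meval => i; apply: ratl_coords; apply: rconj.
Qed.

Lemma line_triple_GL3 t : det_line t != 0 -> GL3 (line_triple t).
Proof.
move=> /det_line_neq0[la0 AU BU]; split => //=.
by rewrite unitmx_tr unitmxZ ?unitmx_inv // unitfE invr_eq0.
Qed.

Lemma line_triple_sym t : det_line t != 0 -> act (line_triple t) T0 = T0.
Proof.
move=> dt; have [la0 AU BU] := det_line_neq0 dt.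
apply/(symmetry_T0P m_gt0 (line_triple_GL3 dt)).
have [e1 _] := (symmetry_T0P m_gt0 g1G).1 g1T.
have [e2 _] := (symmetry_T0P m_gt0 g2G).1 g2T.
split=> [r ro|]; first by rewrite /= !mxE e1 // e2 // !mulr0 addr0.
by rewrite /= trmxK -scalemxAr mulmxV // scalerA mulfV // scale1r.
Qed.

Lemma line_triple_within S t : within S g1 -> within S g2 -> within S (line_triple t).
Proof.
move=> S1 S2 a aS; have := S1 a aS; have := S2 a aS; case: a {aS} => p /= e2 e1.
  rewrite !mxE; transitivity ((1 - t) * 0 + t * 0 : K); last by rewrite !mulr0 addr0.
  by rewrite -{1}e1 -e2; ring.
rewrite !mxE; transitivity ((1 - t) * 0 + t * 0 : K); last by rewrite !mulr0 addr0.
by rewrite -{1}e1 -e2; ring.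
Qed.

Lemma third_component g : GL3 g -> act g T0 = T0 ->
  g.1.1 o o != 0 /\ ((g.1.1 o o)^-1 *: invmx g.1.2)^T = g.2.
Proof.
move=> Gg /(symmetry_T0P m_gt0 Gg)[_ e]; have [_ gB _] := Gg.
have l0 : g.1.1 o o != 0.
  apply/eqP => l0; have := e; rewrite l0 scale0r => /matrixP/(_ o o)/eqP.
  by rewrite !mxE eqxx eq_sym oner_eq0.
split=> //; rewrite -[RHS]trmxK; congr _^T.
by rewrite -[invmx _]mulmx1 -e -scalemxAr mulKmx // scalerA mulVf // scale1r.
Qed.

Lemma line_triple0 : line_triple 0 = g1 /\ det_line 0 != 0.
Proof.
have [l0 e] := third_component g1G g1T; have [ga gb _] := g1G.
rewrite /line_triple /det_line /lineA /lineB subr0 !scale1r !scale0r !addr0 e.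
split; first by case: (g1) => -[].
by rewrite !mulf_neq0 // -unitfE -unitmxE.
Qed.

Lemma line_triple1 : line_triple 1 = g2 /\ det_line 1 != 0.
Proof.
have [l0 e] := third_component g2G g2T; have [ga gb _] := g2G.
rewrite /line_triple /det_line /lineA /lineB subrr !scale1r !scale0r !add0r e.
split; first by case: (g2) => -[].
by rewrite !mulf_neq0 // -unitfE -unitmxE.
Qed.

End Line.

Lemma stratum_irreducible S : irreducible (@zariski_closed K m) (stratum S).
Proof.
split; first by exists (coset (scalar_triple m 1 1 1)); apply: stratum_id.
move=> Z1 Z2 [I1 Z1E] [I2 Z2E] SZ; apply: contrapT => /not_orP[n1 n2].
(* A point of the stratum outside [Z] is detected by an equation of [Z] that is nonzero there. *)
have wit Z I : @GL3 K m `&` @coset K m @^-1` Z = @GL3 K m `&` zero_locus I ->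
    ~ stratum S `<=` Z -> exists g f, [/\ GL3 g, act g T = T,
      within S (transport g), I f & f.@[pt g] != 0].
  move=> ZE nZ; apply: contrapT => nex; apply: nZ => c [g [Gg [gT gS]] <-].
  suff : (@GL3 K m `&` zero_locus I) g by rewrite -ZE => -[].
  split=> // f If; apply/eqP; apply: contrapT => /negP fg.
  by apply: nex; exists g, f.
have [g1 [f1 [G1 T1 S1 If1 f1g]]] := wit _ _ Z1E n1.
have [g2 [f2 [G2 T2 S2 If2 f2g]]] := wit _ _ Z2E n2.
have H1 := GL3_conj G1; have H2 := GL3_conj G2.
have C1 := act_conj T1; have C2 := act_conj T2.
have [l0 d0] := line_triple0 (transport g2) H1 C1.
have [l1 d1] := line_triple1 (transport g1) H2 C2.
have f1l : f1.@[pt (transport_back (line_triple (transport g1) (transport g2) 0))] != 0.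
  by rewrite l0 transportK.
have f2l : f2.@[pt (transport_back (line_triple (transport g1) (transport g2) 1))] != 0.
  by rewrite l1 transportK.
(* The two equations are nonzero at parameters 0 and 1 respectively, hence both are nonzero at some
   [t], which gives a point of the stratum outside [Z1] and [Z2]. *)
have [t [dt f1t f2t]] := ratl_line_common_nonzero (fun t => iff_refl _)
  (ratl_det_line (transport g1) (transport g2)) 
  (ratl_line_triple (transport g1) (transport g2) f1)
  (ratl_line_triple (transport g1) (transport g2) f2)
  d0 f1l d1 f2l.
have wG := line_triple_GL3 dt; have wT := line_triple_sym H1 H2 C1 C2 dt.
set w := line_triple _ _ t in wG wT f1t f2t.
have wS : stratum S (coset (transport_back w)).
  apply/stratum_coset; first exact: GL3_unconj.
  by split; [apply: act_unconj|rewrite transport_backK; apply: line_triple_within].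
have out Z I f : @GL3 K m `&` @coset K m @^-1` Z = @GL3 K m `&` zero_locus I ->
    I f -> f.@[pt (transport_back w)] != 0 -> ~ Z (coset (transport_back w)).
  move=> ZE If /eqP fw Zw.
  have : (@GL3 K m `&` @coset K m @^-1` Z) (transport_back w).
    by split => //; apply: GL3_unconj.
  by rewrite ZE => -[_ /(_ _ If)].
by case: (SZ _ wS); [apply: out Z1E If1 f1t|apply: out Z2E If2 f2t].
Qed.

Lemma stratum_sub S S' : {subset S <= S'} -> stratum S `<=` stratum S'.
Proof.
move=> SS' c [g [Gg [gT gS]] <-]; exists g => //; split => //; split => // a aS'.
by apply: gS; apply: contra aS'; apply: SS'.
Qed.

(* The positions that [symmetry_T0P] leaves free, modulo scalars. *)
Definition free_pos (a : pos) : bool :=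
  match a with inl p => p.2 != o | inr p => p != (o, o) end.

(** The witness is an elementary change of the identity whose only nonzero defect is at [a]. In the
    A-component a free position avoids the first column, so [a_1] stays fixed; a change in the
    B-component is compensated by the inverse transpose in C. *)
Lemma stratum_neq S S' a : free_pos a -> a \in S' -> a \notin S ->
  ~ stratum S' `<=` stratum S.
Proof.
move=> fa aS' aS.
pose E (p : 'I_m * 'I_m) : 'M[K]_m := 1%:M + delta_mx p.1 p.2.
have EU p : E p \in unitmx by apply: unitmx_1_delta.
pose w : mx_triple K m := match a with
  | inl p => (E p, 1%:M, 1%:M) | inr p => (1%:M, E p, (invmx (E p))^T) end.
have wG : GL3 w.
  rewrite /w; case: (a) => p; split; rewrite /= ?unitmx1 //.
  by rewrite unitmx_tr unitmx_inv.
have wT : act w T0 = T0.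
  apply/(symmetry_T0P m_gt0 wG); rewrite /w; case: (a) fa => -[p q] /= fa.
    split=> [r ro|]; first by rewrite !mxE (negbTE ro) [o == q]eq_sym (negbTE fa) andbF addr0.
    by rewrite mul1mx trmx1 !mxE eqxx [o == q]eq_sym (negbTE fa) andbF addr0 scale1r.
  split=> [r ro|]; first by rewrite !mxE (negbTE ro).
  by rewrite trmxK mulmxV // mxE eqxx scale1r.
have Eoo p : p != (o, o) -> E p o o = 1.
  by case: p => p q pq; rewrite !mxE eqxx -xpair_eqE eq_sym (negbTE pq) addr0.
have fa' : match a with inl p => p != (o, o) | inr p => p != (o, o) end.
  by case: (a) fa => // -[p q] /=; apply: contra => /eqP[_ ->].
have id_defect (p : 'I_m * 'I_m) :
    (1%:M : 'M[K]_m) p.1 p.2 - (p.1 == p.2)%:R * (1%:M : 'M[K]_m) o o = 0.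
  by rewrite !mxE eqxx mulr1 subrr.
have E_defect p (r : 'I_m * 'I_m) : p != (o, o) ->
    E p r.1 r.2 - (r.1 == r.2)%:R * E p o o = (r == p)%:R.
  move=> po; rewrite (Eoo _ po) mulr1 !mxE addrAC subrr add0r.
  by case: p r {po} => p q [r s].
have wdef b : defect b w = (b == a)%:R.
  rewrite /w; case: (a) fa' => p po; case: b => r /=; rewrite ?id_defect ?E_defect //.
have wS' : stratum S' (coset (transport_back w)).
  apply/stratum_coset; first exact: GL3_unconj.
  split; first exact: act_unconj.
  rewrite transport_backK => b bS'; rewrite wdef; case: eqP => // ba.
  by rewrite ba aS' in bS'.
move=> /(_ _ wS') /(stratum_coset _ (GL3_unconj wG))[_].
by rewrite transport_backK => /(_ a aS)/eqP; rewrite wdef eqxx oner_eq0.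
Qed.

Definition free_seq : seq pos :=
  map (fun a : 'I_m * {q : 'I_m | q != o} + {p : 'I_m * 'I_m | p != (o, o)} =>
         match a with inl (p, q) => inl (p, val q) | inr p => inr (val p) end)
    (enum {: 'I_m * {q : 'I_m | q != o} + {p : 'I_m * 'I_m | p != (o, o)}}).

Lemma size_free_seq : size free_seq = (2 * m ^ 2 - m - 1)%N.
Proof.
rewrite size_map -cardE card_sum card_prod !card_sig card_ord.
have -> : #|[pred q : 'I_m | q != o]| = m.-1.
  by rewrite -[RHS](congr1 predn (card_ord m)) -(cardC1 o); apply: eq_card.
have -> : #|[pred p : 'I_m * 'I_m | p != (o, o)]| = (m * m).-1.
  transitivity #|predC1 (o, o)|; first by apply: eq_card.
  by rewrite cardC1 card_prod card_ord.
by case: (m) m_gt0 => // n _; rewrite -mulnn; lia.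
Qed.

Lemma free_seq_uniq : uniq free_seq.
Proof.
rewrite map_inj_uniq ?enum_uniq // => -[[p q]|p] [[p' q']|p'] //=.
  by move=> [-> /val_inj ->].
by move=> [/val_inj ->].
Qed.

Lemma free_seqP a : a \in free_seq -> free_pos a.
Proof. by case/mapP => -[[p q]|p] _ ->; [apply: (valP q)|apply: (valP p)]. Qed.

Lemma symmetry_chain_exists :
  exists F, irreducible_chain (@zariski_closed K m) (symmetry_group T)
    (2 * m ^ 2 - m - 1) F.
Proof.
exists (fun i => stratum (take i free_seq)); split=> i.
  by move=> _; split; [apply: stratum_closed|apply: stratum_irreducible].
rewrite -size_free_seq => lt_i; split.
  apply: stratum_sub => a ai.
  by rewrite (take_nth (inl (o, o)) lt_i) mem_rcons inE ai orbT.
pose a := nth (inl (o, o)) free_seq i.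
apply: (@stratum_neq _ _ a).
- by apply/free_seqP/mem_nth.
- by rewrite (take_nth (inl (o, o)) lt_i) mem_rcons mem_head.
- have : uniq (take i free_seq ++ drop i free_seq).
    by rewrite cat_take_drop free_seq_uniq.
  rewrite cat_uniq (drop_nth (inl (o, o)) lt_i) /= negb_or.
  by case/and3P => _ /andP[].
Qed.

End LowerBound.

(** * The dimension bound and the case of equality *)

Theorem proposition3p1 (R : realType) (m : nat) (m_gt0 : (0 < m)%N)
    (T : tensor R[i] m) (T_gen : one_A_generic T) :
  dim_symmetry_group_le T (2 * m ^ 2 - m - 1) /\
  (dim_symmetry_group_eq T (2 * m ^ 2 - m - 1) <->
   isomorphic T (tensor_T0 R[i] m_gt0)).
Proof.
have [alpha rk_alpha] := T_gen.
have alphaU : flattening_A T alpha \in unitmx.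
  by rewrite -row_full_unit /row_full rk_alpha.
have k_gt0 : (0 < \rank (flat T))%N.
  rewrite lt0n mxrank_eq0; apply: contraTneq alphaU => F0.
  rewrite flattening_AE F0 mulmx0 linear0.
  by apply/negP => /(unitmx_neq0 m_gt0)/eqP.
have k_le : (\rank (flat T) <= m)%N := rank_leq_row _.
(* The parameter count [k + m (m - k) + m ^ 2] equals [2 m ^ 2 - k (m - 1)], stated here without
   subtracting the term in [k]. *)
have bound n F : irreducible_chain (@zariski_closed R[i] m) (symmetry_group T) n F ->
    (n.+2 + \rank (flat T) * m.-1 <= 2 * m ^ 2)%N.
  move=> /(symmetry_chain_le m_gt0 alphaU).
  rewrite mulnBr -mulnn.
  have : (m * \rank (flat T) <= m * m)%N by rewrite leq_mul2l k_le orbT.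
  have -> : (\rank (flat T) * m.-1 = m * \rank (flat T) - \rank (flat T))%N.
    by rewrite -subn1 mulnBr muln1 mulnC.
  have : (\rank (flat T) <= m * \rank (flat T))%N by rewrite leq_pmull.
  by lia.
have le : dim_symmetry_group_le T (2 * m ^ 2 - m - 1).
  move=> n F /bound; have : (m.-1 <= \rank (flat T) * m.-1)%N by rewrite leq_pmull.
  by lia.
split=> //; split=> [[[F /bound nk] _]|[h hG hT]]; last first.
  by split=> //; apply: symmetry_chain_exists hG hT.
apply: (rank1_isomorphic m_gt0 alphaU).
(* This keeps the natural subtraction in the dimension from truncating. If [k >= 2] then [m >= 2],
   and the bound falls short of that dimension by at least [m - 1]. *)
have : (m < 2 * m ^ 2)%N by rewrite -mulnn; nia.
move: nk; have [k1|k2] := leqP (\rank (flat T)) 1; first by lia.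
have : (2 * m.-1 <= \rank (flat T) * m.-1)%N by rewrite leq_mul2r k2 orbT.
by lia.
Qed.
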